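(* Let $d\ge 2$, $0<p<p_c(d)$ and $0<\alpha_1<1<\alpha_2$. There exists a constant $C=C(p,d,\alpha_1,\alpha_2)$ such that for all $t\ge 1$ and every deterministic connected set $\Gamma\subset\mathbf{R}^d$ with $\alpha_1 tB_d\subset\Gamma\subset\alpha_2 tB_d$, $$E(|R_\Gamma|)\le C\,t,$$ where $R_\Gamma$ is the set of all vertices lying on at least one route for $T(\mathbf{0},\partial\Gamma)$ and $|R_\Gamma|$ is its cardinality.
   Context: First passage percolation on $\mathbf{Z}^d$: edges join pairs of vertices at Euclidean distance $1$. Each edge $e$ is independently assigned $t(e)\in\{0,1\}$ with $P(t(e)=0)=p$, $P(t(e)=1)=1-p$; $E$ is expectation under the product measure $P=P_p$. $p_c(d)$ is the critical probability of Bernoulli bond percolation on $\mathbf{Z}^d$. A path $\gamma$ is a finite alternating sequence $(v_0,e_1,v_1,\dots,e_n,v_n)$ of vertices and edges, each $e_i$ joining $v_{i-1}$ and $v_i$; $T(\gamma)=\sum_{i=1}^n t(e_i)$. For vertex sets $A,B$, $T(A,B)$ is the infimum of $T(\gamma)$ over all paths from a vertex of $A$ to a vertex of $B$; a path from $A$ to $B$ with $T(\gamma)=T(A,B)$ is called a route for $T(A,B)$. For $x,y\in\mathbf{R}^d$, $T(x,y)=T(x',y')$ with $x',y'$ the nearest vertices of $\mathbf{Z}^d$ (ties broken by a fixed order). For $x\in\mathbf{R}^d$, $\mu_p(x)=\lim_{n\to\infty}\frac1n T(\mathbf{0},nx)$ (the limit exists a.s. and in $L_1$ and is non-random). For $p<p_c(d)$,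 $\mu_p$ is a norm on $\mathbf{R}^d$, and $B_d=B_d(p)=\{x:\mu_p(x)\le1\}$ is a compact convex set (the asymptotic shape). For $\Gamma\subset\mathbf{R}^d$ put $\Gamma'=\Gamma\cap\mathbf{Z}^d$, and let $\partial\Gamma'$ be the set of vertices of $\Gamma'$ adjacent to at least one vertex of $\mathbf{Z}^d\setminus\Gamma'$. $T(\mathbf{0},\partial\Gamma)$ means $T(\{\mathbf{0}\},\partial\Gamma')$. *)

(* Defs.v *)
From HB Require Import structures.
From mathcomp Require Import all_boot all_order all_algebra finmap.
From mathcomp Require Import all_classical all_reals all_analysis.

Set Implicit Arguments.
Unset Strict Implicit.
Unset Printing Implicit Defensive.

Import Order.TTheory GRing.Theory Num.Theory.
Import numFieldNormedType.Exports.

Local Open Scope classical_set_scope.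
Local Open Scope ring_scope.

Definition vertex (d : nat) := 'rV[int]_d.

Definition sqdist (K : pzRingType) (d : nat) (x y : 'rV[K]_d) : K :=
  \sum_(i < d) (x ord0 i - y ord0 i) ^+ 2.

(* Euclidean distance 1. *)
Definition adjacent (d : nat) (x y : vertex d) : bool := sqdist x y == 1.

Definition is_edge (d : nat) (e : {fset 'rV[int]_d}) : bool :=
  `[< exists x y : vertex d, adjacent x y /\ e = [fset x; y]%fset >].

Definition edge (d : nat) := {e : {fset 'rV[int]_d} | is_edge e}.

(* The configuration space {0,1}^edges with the sigma-algebra generated by the
   coordinates; [w e = true] encodes t(e) = 1 and [w e = false] encodes
   t(e) = 0. *)
Definition coordinate_events (d : nat) : set (set (edge d -> bool)) :=
  [set A | exists (e : edge d) (b : bool), A = [set w | w e = b]].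

Definition config (d : nat) := g_sigma_algebraType (@coordinate_events d).

(* [P] is the product measure P_p under which every edge has t(e) = 0 with
   probability p and t(e) = 1 with probability 1 - p.  Such a measure exists
   for 0 <= p <= 1 (Kolmogorov) and these cylinder probabilities determine
   it. *)
Definition is_product_measure (R : realType) (d : nat) (p : R)
    (P : probability (config d) R) : Prop :=
  forall (s : {fset edge d}) (b : edge d -> bool),
    P [set w : config d | forall e, e \in s -> w e = b e] =
    (\prod_(e <- s) (if b e then 1 - p else p))%:E.

(* The path (v_0, e_1, v_1, ..., e_n, v_n) is represented by the pair of v_0
   and the sequence (e_1, v_1), ..., (e_n, v_n). *)
Fixpoint is_path (d : nat) (x : vertex d) (s : seq (edge d * vertex d)) : bool :=
  if s is (e, y) :: s' then (val e == [fset x; y]%fset) && is_path y s'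
  else true.

Record lpath (d : nat) := LPath {
  lpath_start : vertex d;
  lpath_steps : seq (edge d * vertex d);
  lpathP : is_path lpath_start lpath_steps
}.

Definition lpath_end (d : nat) (g : lpath d) : vertex d :=
  last (lpath_start g) (unzip2 (lpath_steps g)).

Definition lpath_vertices (d : nat) (g : lpath d) : seq (vertex d) :=
  lpath_start g :: unzip2 (lpath_steps g).

Definition paths_between (d : nat) (A B : set (vertex d)) : set (lpath d) :=
  [set g | A (lpath_start g) /\ B (lpath_end g)].

Definition path_time (d : nat) (w : config d) (g : lpath d) : nat :=
  \sum_(s <- lpath_steps g) nat_of_bool (w s.1).

(* Extended-real valued, so that the infimum over an empty family is +oo. *)
Definition passage_time (R : realType) (d : nat) (w : config d)
    (A B : set (vertex d)) : \bar R :=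
  ereal_inf [set ((path_time w g)%:R : R)%:E | g in paths_between A B].

Definition is_route (R : realType) (d : nat) (w : config d)
    (A B : set (vertex d)) (g : lpath d) : Prop :=
  paths_between A B g /\ ((path_time w g)%:R : R)%:E = passage_time R w A B.

Definition embed (R : realType) (d : nat) (v : vertex d) : 'rV[R]_d :=
  map_mx intr v.

(* Ties are broken by the order in which [pickle] enumerates the countable type
   of vertices. *)
Definition nearest_vertex (R : realType) (d : nat) (x : 'rV[R]_d) : vertex d :=
  xget 0 [set v : vertex d |
    (forall u : vertex d, sqdist x (embed R v) <= sqdist x (embed R u)) /\
    (forall u : vertex d, sqdist x (embed R u) = sqdist x (embed R v) ->
       (choice.pickle v <= choice.pickle u)%N)].

Definition passage_time_pt (R : realType) (d : nat) (w : config d)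
    (x y : 'rV[R]_d) : \bar R :=
  passage_time R w [set nearest_vertex x] [set nearest_vertex y].

(* The L_1 limit of T(0, nx)/n, which is the same constant as its almost sure
   limit; an L_1 limit is unique, so [get] selects nothing beyond it. *)
Definition time_constant (R : realType) (d : nat) (P : probability (config d) R)
    (x : 'rV[R]_d) : R :=
  get [set m : R |
    (fun n : nat =>
       (\int[P]_w `|(n%:R^-1)%:E * passage_time_pt w 0 (n%:R *: x) - m%:E|)%E)
      @ \oo --> 0%E].

Definition asymptotic_shape (R : realType) (d : nat)
    (P : probability (config d) R) : set 'rV[R]_d :=
  [set x | time_constant P x <= 1].

Definition dilate (R : realType) (d : nat) (a : R) (A : set 'rV[R]_d) :
    set 'rV[R]_d :=
  [set a *: x | x in A].

Definition open_cluster (d : nat) (w : config d) : set (vertex d) :=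
  [set v | exists g : lpath d,
    [/\ lpath_start g = 0, lpath_end g = v &
        forall s, s \in lpath_steps g -> w s.1 = false]].

(* The critical probability sup {q : theta(q) = 0}, an edge being open when
   t(e) = 0, so that each edge is open with probability q under P_q. *)
Definition critical_probability (R : realType) (d : nat) : R :=
  sup [set q : R | 0 <= q <= 1 /\
    exists P : probability (config d) R, is_product_measure q P /\
      P [set w : config d | infinite_set (open_cluster w)] = 0%E].

Definition lattice_points (R : realType) (d : nat) (G : set 'rV[R]_d) :
    set (vertex d) :=
  [set v | G (embed R v)].

Definition lattice_boundary (R : realType) (d : nat) (G : set 'rV[R]_d) :
    set (vertex d) :=
  [set v | lattice_points G v /\
           exists u : vertex d, adjacent v u /\ ~ lattice_points G u].

Definition route_vertices (R : realType) (d : nat) (w : config d)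
    (G : set 'rV[R]_d) : set (vertex d) :=
  [set v | exists g : lpath d,
    is_route R w [set 0] (lattice_boundary G) g /\ v \in lpath_vertices g].

(* Main.v *)
Require Import Defs.
From HB Require Import structures.
From mathcomp Require Import all_boot all_order all_algebra finmap.
From mathcomp Require Import all_classical all_reals all_analysis.
From mathcomp Require Import measurable_realfun.
From mathcomp Require Import zify ring lra.

Set Implicit Arguments.
Unset Strict Implicit.
Unset Printing Implicit Defensive.

Import Order.TTheory GRing.Theory Num.Theory.
Import numFieldNormedType.Exports.

Local Open Scope classical_set_scope.
Local Open Scope ring_scope.

(** Call an edge open if its passage time is 0 and closed if it is 1.  The
    boundary of [G] is reached from the origin within [O(t)] steps, so every
    route has [O(t)] closed edges; the task is to bound the number of vertices of
    all routes together.

    Animals.  Below the critical probability open clusters have an exponential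
    moment, and this is still so at a parameter slightly larger than [p]
    ([subcritical_moment]).  Consider a random set of vertices [U] that is
    connected to the origin through open edges and through [N] closed edges.
    Opening each closed edge with a small probability [lam] makes [U] a part of an
    open cluster with probability at least [lam ^ N].  Hence the mean of
    [lam ^ N * exp (th * |U|)] is bounded, and by convexity
    [E |U| <= C (1 + E N)] ([mean_animal]).

    Pivotal edges.  Taking for [U] a single route shows that one route has [O(t)]
    edges in the mean.  A closed edge of any route is pivotal, since opening it
    lowers the passage time.  An open pivotal edge lies on every route, so there
    are [O(t)] of these in the mean.  Being pivotal is independent of the state of
    the edge, so closed and open pivotal edges are in proportion [1 - p] to [p],
    and the closed edges that lie on some route are [O(t)] in number
    ([mean_closed_on_route]).  The set of all vertices of all routes is held
    together by these closed edges, and [mean_animal] applies to it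
    ([mean_route_points]).

    Exponential moments.  If from each finite set around the origin at least one
    edge led out on average, at parameter [p], then the differential inequality
    of Duminil-Copin and Tassion would make the probability to leave a box larger
    than a positive constant at every larger parameter, uniformly in the box
    ([leaves_lower_bound]), and infinite clusters would appear.  So below
    criticality there is a finite set from which the cluster of the origin has on
    average fewer than one exit ([subcritical_exit_rate]).  Explored in translates
    of this set, a cluster grows at most like a subcritical branching process with
    bounded offspring ([cluster_exp_moment]).

    All probabilistic estimates are made for finitely many edges, where
    expectations are finite sums ([Ex]); Fatou's lemma along growing boxes carries
    the result to the lattice ([mean_routes]).

    The asymptotic shape only enters through the distance from the origin to the
    boundary.  If some lattice vertex is outside [G], then the time constant of a
    multiple of it exceeds 1.  There it is a true limit, and it is homogeneous
    along the ray ([time_constant_ray]), so that the multiples of this one vertex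
    leave every [G] after [O(t)] steps. *)

(** * Expectation over finitely many independent edges *)

Section Expectation.
Variables (R : realType) (E : choiceType).
Implicit Types (q : R) (s : seq E) (w : E -> bool) (e : E) (f g : (E -> bool) -> R).

Definition upd w e (b : bool) : E -> bool := fun e' => if e' == e then b else w e'.

Lemma upd_same w e b : upd w e b e = b.
Proof. by rewrite /upd eqxx. Qed.

Lemma upd_other w e b e' : e' != e -> upd w e b e' = w e'.
Proof. by rewrite /upd => /negbTE ->. Qed.

Lemma upd_swap w e e' b b' : e != e' ->
  upd (upd w e b) e' b' = upd (upd w e' b') e b.
Proof.
move=> ne; apply/funext => x; rewrite /upd.
by case: (eqVneq x e') => // ->; rewrite eq_sym (negbTE ne).
Qed.

Lemma upd_upd w e b b' : upd (upd w e b) e b' = upd w e b'.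
Proof. by apply/funext => x; rewrite /upd; case: eqP. Qed.

(** The recursion conditions on one edge at a time, the edges outside [s] being
    frozen as in [w]; in this form conditional expectations, product measures
    and derivatives in [q] are all handled by induction on [s]. *)
Fixpoint Ex q s f w : R :=
  if s is e :: s' then
    q * Ex q s' f (upd w e false) + (1 - q) * Ex q s' f (upd w e true)
  else f w.

Definition depends_on (A : set E) f :=
  forall w w', (forall e, A e -> w e = w' e) -> f w = f w'.

Lemma depends_on_sub (A B : set E) f : A `<=` B -> depends_on A f -> depends_on B f.
Proof. by move=> AB fA w w' ww'; apply: fA => e /AB /ww'. Qed.

Lemma depends_on_indic (A : set E) (Q : (E -> bool) -> Prop) :
  (forall w w', (forall e, A e -> w e = w' e) -> Q w -> Q w') ->
  depends_on A (fun w => (`[< Q w >])%:R).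
Proof.
move=> AQ w w' ww'; congr (_%:R); congr nat_of_bool; apply/asbool_equiv_eq.
by split; apply: AQ => // e /ww' ->.
Qed.

Lemma eq_Ex q s f g w : f =1 g -> Ex q s f w = Ex q s g w.
Proof. by move=> /funext ->. Qed.

Lemma ExD q s f g w : Ex q s (fun w => f w + g w) w = Ex q s f w + Ex q s g w.
Proof. by elim: s w => //= e s IH w; rewrite !IH; ring. Qed.

Lemma ExZ q s c f w : Ex q s (fun w => c * f w) w = c * Ex q s f w.
Proof. by elim: s w => //= e s IH w; rewrite !IH; ring. Qed.

Lemma ExZr q s c f w : Ex q s (fun w => f w * c) w = Ex q s f w * c.
Proof. by elim: s w => //= e s IH w; rewrite !IH; ring. Qed.

Lemma Ex_cst q s c w : Ex q s (fun=> c) w = c.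
Proof. by elim: s w => //= e s IH w; rewrite !IH; ring. Qed.

Lemma ExB q s f g w : Ex q s (fun w => f w - g w) w = Ex q s f w - Ex q s g w.
Proof. by elim: s w => //= e s IH w; rewrite !IH; ring. Qed.

Lemma Ex_sum q s (I : Type) (r : seq I) (F : I -> (E -> bool) -> R) w :
  Ex q s (fun w => \sum_(i <- r) F i w) w = \sum_(i <- r) Ex q s (F i) w.
Proof.
elim: r => [|i r IH].
  by rewrite big_nil (eq_Ex _ _ (g := fun=> 0)) ?Ex_cst// => w'; rewrite big_nil.
rewrite big_cons -IH -ExD; apply: eq_Ex => w'; exact: big_cons.
Qed.

Lemma Ex_cat q s1 s2 f w : Ex q (s1 ++ s2) f w = Ex q s1 (Ex q s2 f) w.
Proof. by elim: s1 w => //= e s1 IH w; rewrite !IH. Qed.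

Lemma depends_on_Ex q s A f : depends_on A f ->
  depends_on (A `\` [set` s]) (Ex q s f).
Proof.
elim: s => [|e s IH] fA w w' ww' /=.
  by apply: fA => e Ae; apply: ww'; split.
by congr (_ * _ + _ * _); apply: IH => // e' [Ae' es']; rewrite /upd; case: eqP => // /eqP ne;
  apply: ww'; split=> //=; rewrite inE (negbTE ne).
Qed.

Lemma Ex_indep q s A f w : depends_on A f -> (forall e, e \in s -> ~ A e) ->
  Ex q s f w = f w.
Proof.
elim: s w => //= e s IH w fA sA.
have h b : f (upd w e b) = f w.
  apply: fA => e' Ae'; rewrite upd_other//; apply: contraPneq Ae' => ->.
  by apply: sA; rewrite mem_head.
by rewrite !IH ?h; [ring|move=> // e' es; apply: sA; rewrite inE es orbT..].
Qed.

Lemma Ex_mul q s A f g w : depends_on A f -> depends_on (~` A) g ->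
  Ex q s (fun w => f w * g w) w = Ex q s f w * Ex q s g w.
Proof.
elim: s w => //= e s IH w fA gA; rewrite !IH//.
case: (pselect (A e)) => Ae.
- have h b : Ex q s g (upd w e b) = Ex q s g w.
    apply: (depends_on_Ex _ _ (A := ~` A)) => // e' [Ae' _]; rewrite upd_other//.
    by apply: contra_notN Ae' => /eqP ->.
  by rewrite !h; ring.
- have h b : Ex q s f (upd w e b) = Ex q s f w.
    apply: (depends_on_Ex _ _ (A := A)) => // e' [Ae' _]; rewrite upd_other//.
    by apply: contra_notN Ae => /eqP <-.
  by rewrite !h; ring.
Qed.

Lemma Ex_perm q s s' f w : perm_eq s s' -> Ex q s f w = Ex q s' f w.
Proof.
have sw e e' t v : Ex q [:: e, e' & t] f v = Ex q [:: e', e & t] f v.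
  have [->//|ne] := eqVneq e e'.
  by rewrite /= !(upd_swap _ _ _ ne); ring.
elim: s s' w => [|e s IH] s' w.
  by rewrite perm_sym => /perm_nilP ->.
have mv (s1 s2 : seq E) v : Ex q (e :: s1 ++ s2) f v = Ex q (s1 ++ e :: s2) f v.
  elim: s1 v => // a s1 IH1 v; rewrite !cat_cons sw /=.
  by move: (IH1 (upd v a false)) (IH1 (upd v a true)) => /= -> ->.
move=> ps.
have es' : e \in s' by rewrite -(perm_mem ps) mem_head.
case/splitPr: s' / es' ps => s1 s2 ps.
rewrite -mv /=; move: ps; rewrite perm_sym -(cat1s e s2) perm_catCA perm_cons perm_sym => ps.
by rewrite !(IH _ _ ps).
Qed.

Section Mono.
Variable q : R.
Hypotheses (q0 : 0 <= q) (q1 : q <= 1).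

Lemma le_Ex s f g w : (forall w, f w <= g w) -> Ex q s f w <= Ex q s g w.
Proof.
move=> fg; elim: s w => //= e s IH w.
by apply: lerD; apply: ler_wpM2l; rewrite ?subr_ge0.
Qed.

Lemma Ex_ge0 s f w : (forall w, 0 <= f w) -> 0 <= Ex q s f w.
Proof. by move=> f0; rewrite -(Ex_cst q s 0 w); apply: le_Ex. Qed.

End Mono.

Lemma Ex_filter q s A f w : depends_on A f ->
  Ex q s f w = Ex q [seq e <- s | `[< A e >]] f w.
Proof.
move=> fA.
rewrite -(Ex_perm _ _ _ (permEl (perm_filterC (fun e => `[< A e >]) s))) Ex_cat.
apply: eq_Ex => w'; apply: (Ex_indep _ _ fA) => e.
by rewrite mem_filter => /andP[/= /asboolPn].
Qed.

Lemma eq_Ex_on q s s' A f w : uniq s -> uniq s' -> depends_on A f ->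
  (forall e, A e -> (e \in s) = (e \in s')) -> Ex q s f w = Ex q s' f w.
Proof.
move=> us us' fA ss'; rewrite (Ex_filter _ _ _ fA) [RHS](Ex_filter _ _ _ fA).
apply: Ex_perm; apply: uniq_perm; rewrite ?filter_uniq// => e.
by rewrite !mem_filter; case: (asboolP (A e)) => //= /ss' ->.
Qed.

(** As [true] stands for a closed edge, these are the functions that increase with
    the set of open edges. *)
Definition decreasing f := forall w w', (forall e, w' e -> w e) -> f w <= f w'.

Lemma upd_le w w' e b : (forall e, w' e -> w e) ->
  forall e', upd w' e b e' -> upd w e b e'.
Proof. by move=> h e'; rewrite /upd; case: eqP => // _; apply: h. Qed.

Lemma decreasing_Ex q s f : 0 <= q <= 1 -> decreasing f -> decreasing (Ex q s f).
Proof.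
move=> /andP[q0 q1] df; elim: s => //= e s IH w w' ww'.
by apply: lerD; apply: ler_wpM2l; rewrite ?subr_ge0//; apply: IH; apply: upd_le.
Qed.

Lemma Ex_le_param q q' s f w : 0 <= q -> q <= q' -> q' <= 1 -> decreasing f ->
  Ex q s f w <= Ex q' s f w.
Proof.
move=> q0 qq' q1 df; elim: s w => //= e s IH w.
have h : Ex q' s f (upd w e true) <= Ex q' s f (upd w e false).
  apply: decreasing_Ex => //; first by rewrite (le_trans q0 qq').
  by move=> e'; rewrite /upd; case: eqP.
have := IH (upd w e false); have := IH (upd w e true); nra.
Qed.

(** The state of an edge is independent of every function that does not look at it. *)
Lemma Ex_edge q s e f w : uniq s -> e \in s -> depends_on (~` [set e]) f ->
  (Ex q s (fun w => (~~ w e)%:R * f w) w = q * Ex q s f w) *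
  (Ex q s (fun w => (w e)%:R * f w) w = (1 - q) * Ex q s f w).
Proof.
move=> us es fe.
have aux (c : bool -> R) :
    Ex q s (fun w => c (w e) * f w) w = (q * c false + (1 - q) * c true) * Ex q s f w.
  rewrite (Ex_mul _ _ _ (A := [set e])) //; last by move=> v v' h /=; rewrite (h e).
  congr (_ * _).
  have -> : Ex q s (fun w => c (w e)) w = Ex q [:: e] (fun w => c (w e)) w.
    apply: (eq_Ex_on _ _ (A := [set e])) => //; first by move=> v v' h; rewrite (h e).
    by move=> e' ->; rewrite es mem_head.
  by rewrite /= !upd_same.
split; first by rewrite (aux (fun b => (~~ b)%:R)) /=; ring.
by rewrite (aux (fun b => b%:R)) /=; ring.
Qed.

Lemma Ex_upd q s f e b w : e \notin s ->
  Ex q s (fun w => f (upd w e b)) w = Ex q s f (upd w e b).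
Proof.
elim: s w => //= a s IH w; rewrite inE negb_or => /andP[ne es].
by rewrite !IH// !(upd_swap _ _ _ ne).
Qed.

(** Russo's formula: the derivative in the common parameter is the sum of the
    derivatives in the parameters of the single edges. *)
Lemma Russo s f w q : uniq s ->
  is_derive q (1 : R) (fun q => Ex q s f w)
    (\sum_(e <- s) Ex q s (fun w => f (upd w e false) - f (upd w e true)) w).
Proof.
elim: s w => [|e s IH] w /=; first by move=> _; rewrite big_nil; exact: is_derive_cst.
move=> /andP[es us].
have I0 := IH (upd w e false) us; have I1 := IH (upd w e true) us.
apply: is_derive_eq.
rewrite /GRing.scale /= big_cons !ExB !Ex_upd// !upd_upd big_split /= -!mulr_sumr.
ring.
Qed.

End Expectation.

(** * Connectivity in a locally finite graph *)

Section Indicator.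
Variable R : realType.

Definition ind (P : Prop) : R := (`[< P >])%:R.

Lemma ind_ge0 P : 0 <= ind P.
Proof. exact: ler0n. Qed.

Lemma ind_true (P : Prop) : P -> ind P = 1.
Proof. by move=> /asboolT; rewrite /ind => ->. Qed.

Lemma ind_false (P : Prop) : ~ P -> ind P = 0.
Proof. by move=> /asboolF; rewrite /ind => ->. Qed.

Lemma ind_le (P Q : Prop) : (P -> Q) -> ind P <= ind Q.
Proof.
move=> PQ; case: (pselect P) => [p|/ind_false ->]; last exact: ind_ge0.
by rewrite !ind_true//; apply: PQ.
Qed.

Lemma ind_not (P : Prop) : ind (~ P) = 1 - ind P.
Proof.
case: (pselect P) => p; last by rewrite ind_true// ind_false// subr0.
by rewrite ind_false ?ind_true ?subrr//; apply: contrapT.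
Qed.

Lemma ind_eqv (P Q : Prop) : (P <-> Q) -> ind P = ind Q.
Proof. by move=> /asbool_equiv_eq; rewrite /ind => ->. Qed.

End Indicator.

Lemma ler_sum_sub (R : realType) (I : eqType) (s t : seq I) (F : I -> R) :
  uniq s -> {subset s <= t} -> (forall i, 0 <= F i) ->
  \sum_(i <- s) F i <= \sum_(i <- t) F i.
Proof.
elim: s t => [|a s IH] t /=; first by move=> *; rewrite big_nil sumr_ge0.
move=> /andP[as_ us] st F0.
have at_ : a \in t by apply: st; rewrite mem_head.
rewrite big_cons (big_rem a at_) /= lerD2l; apply: IH => // i is_.
have it : i \in t by apply: st; rewrite inE is_ orbT.
have := perm_mem (perm_to_rem at_) i; rewrite it inE.
by move=> /esym/orP[/eqP ia|//]; rewrite -ia is_ in as_.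
Qed.

(** Decomposing an expectation according to the value [Y] of a random finite set
    turns quantities that depend on [Y] into a sum over deterministic sets [S]. *)
Lemma big_value (R : realType) (T : choiceType) (X Y : {fset T}) (F : {fset T} -> R) :
  (Y `<=` X)%fset -> \sum_(S <- fpowerset X) ind R (Y = S) * F S = F Y.
Proof.
move=> YX; have YP : Y \in fpowerset X by rewrite fpowersetE.
rewrite (bigD1_seq Y) ?fset_uniq//= ind_true// mul1r big1 ?addr0// => S /eqP SY.
by rewrite ind_false ?mul0r// => /esym.
Qed.

(** The relation [g e x y] says that [e] can be followed from [x] to [y]; an edge
    has no other pair of endpoints. *)
Record graph (V E : choiceType) := Graph {
  link :> E -> V -> V -> bool;
  link_ends : forall e x y x' y', link e x y -> link e x' y' ->
    (x' = x /\ y' = y) \/ (x' = y /\ y' = x);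
  link_finite : forall x, finite_set [set e | exists y, link e x y]
}.

Section Graph.
Variables (V E : choiceType) (g : graph V E).
Implicit Types (O A : set E) (C : set V) (S L : {fset V}) (w : E -> bool) (x y z : V).

Definition touches C : set E := [set e | exists x y, C x /\ g e x y].
Definition inside C : set E := [set e | exists x y, [/\ C x, C y & g e x y]].

Lemma inside_touches C : inside C `<=` touches C.
Proof. by move=> e [x [y [Cx Cy exy]]]; exists x, y. Qed.

Lemma touches_mono C C' : C `<=` C' -> touches C `<=` touches C'.
Proof. by move=> CC' e [x [y [/CC' Cx exy]]]; exists x, y. Qed.

Lemma finite_touches S : finite_set (touches [set` S]).
Proof.
have -> : touches [set` S] = \bigcup_(x in [set` S]) [set e | exists y, g e x y].
  apply/seteqP; split=> e; first by move=> [x [y [xS exy]]]; exists x => //; exists y.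
  by move=> [x xS [y exy]]; exists x, y.
apply: bigcup_finite => [|x _]; [exact: finite_fset|exact: link_finite].
Qed.

Definition star S : seq E := fset_set (touches [set` S]).

Lemma mem_star S e : (e \in star S) = `[< touches [set` S] e >].
Proof.
rewrite /star in_fset_set; last exact: finite_touches.
by apply/idP/asboolP => [/set_mem|/mem_set].
Qed.

Lemma starP S e : e \in star S <-> touches [set` S] e.
Proof. by rewrite mem_star; split=> /asboolP. Qed.

Lemma star_uniq S : uniq (star S).
Proof. exact: fset_uniq. Qed.

Lemma star_mono S L : (S `<=` L)%fset -> {subset star S <= star L}.
Proof.
move=> /fsubsetP SL e /starP h; apply/starP; apply: touches_mono h; exact: SL.
Qed.

Inductive conn O x : V -> Prop :=
| conn0 : conn O x x
| conn_step y z e : conn O x y -> O e -> g e y z -> conn O x z.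

Lemma conn_mono O O' x y : O `<=` O' -> conn O x y -> conn O' x y.
Proof. by move=> OO'; elim=> [|a b e _ IH /OO' Oe ab]; [exact: conn0|exact: conn_step ab]. Qed.

Lemma conn_trans O x y z : conn O x y -> conn O y z -> conn O x z.
Proof. by move=> xy; elim=> // a b e _ IH Oe ab; exact: conn_step ab. Qed.

Lemma conn1 O x y e : O e -> g e x y -> conn O x y.
Proof. by move=> Oe; apply: conn_step => //; exact: conn0. Qed.

(** The last visit to [C] of a path: the part of the path after it uses no edge
    with an endpoint in [C]. *)
Lemma last_exit C O x v : conn O x v ->
  [\/ C v, conn (O `\` touches C) x v |
      exists a b e, [/\ C a, ~ C b, O e, g e a b & conn (O `\` touches C) b v]].
Proof.
elim=> [|y z e xy IH Oe yz]; first by apply: Or32; exact: conn0.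
case: (pselect (C z)) => Cz; first exact: Or31.
case: (pselect (C y)) => Cy.
  by apply: Or33; exists y, z, e; split=> //; exact: conn0.
have eC : ~ touches C e.
  by move=> [a [b [Ca ab]]]; case: (link_ends yz ab) => -[h _]; rewrite h in Ca.
case: IH => // [h|[a [b [e' [Ca Cb Oe' ab h]]]]].
- by apply: Or32; apply: conn_step yz.
- by apply: Or33; exists a, b, e'; split=> //; apply: conn_step yz.
Qed.

(** A configuration gives the passage times: open edges are those with value
    [false], crossed at no cost. *)
Definition open_edges A w : set E := A `&` [set e | ~~ w e].

Lemma open_edges_mono A A' w w' : A `<=` A' -> (forall e, A e -> w' e -> w e) ->
  open_edges A w `<=` open_edges A' w'.
Proof. by move=> AA' ww' e [Ae /= we]; split; [exact: AA'|apply: contraNN we => /ww' ->]. Qed.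

Lemma eq_open_edges A w w' : (forall e, A e -> w e = w' e) ->
  open_edges A w = open_edges A w'.
Proof.
by move=> h; apply/seteqP; split; apply: open_edges_mono => // e /h ->.
Qed.

End Graph.

(** * Sharpness of the phase transition *)

Section Sharpness.
Variables (R : realType) (V E : choiceType) (g : graph V E) (o : V).
Implicit Types (S L : {fset V}) (w : E -> bool) (x y z : V) (q : R).

Definition exits S x w e : Prop :=
  exists a b, [/\ a \in S, b \notin S, g e a b &
                  conn g (open_edges (inside g [set` S]) w) x a].

(** Up to the factor [q], the expected number of open edges through which the
    open cluster of [x] in [S] can be left. *)
Definition exit_rate q S x : R :=
  \sum_(e <- star g S) Ex q (star g S) (fun w => ind R (exits S x w e)) xpredT.

Definition leaves L x w : Prop :=
  exists2 v, v \notin L & conn g (open_edges (touches g [set` L]) w) x v.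

Lemma depends_on_exits S x e :
  depends_on (inside g [set` S]) (fun w => ind R (exits S x w e)).
Proof.
apply: depends_on_indic => w w' ww' [a [b [aS bS ab h]]]; exists a, b; split=> //.
by rewrite -(eq_open_edges ww').
Qed.

Lemma decreasing_exits S x e : decreasing (fun w => ind R (exits S x w e)).
Proof.
move=> w w' ww'; apply: ind_le => -[a [b [aS bS ab h]]]; exists a, b; split=> //.
by apply: conn_mono h; apply: open_edges_mono => // e' _ /ww'.
Qed.

Lemma exits_star S x w e : exits S x w e -> e \in star g S.
Proof. by move=> [a [b [aS bS ab _]]]; apply/starP; exists a, b. Qed.

Lemma Ex_star q S L f (w w' : E -> bool) : (S `<=` L)%fset ->
  depends_on (touches g [set` S]) f -> Ex q (star g L) f w = Ex q (star g S) f w' :> R.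
Proof.
move=> SL fS.
transitivity (Ex q (star g S) f w).
  apply: (eq_Ex_on _ _ (star_uniq _ _) (star_uniq _ _) fS) => e /starP eS.
  by rewrite eS (star_mono SL).
apply: (depends_on_Ex _ fS) => e [eS /= es]; exfalso; apply: es; exact/starP.
Qed.

Lemma exit_rate_le_param q q' S x : 0 <= q -> q <= q' -> q' <= 1 ->
  exit_rate q S x <= exit_rate q' S x.
Proof.
by move=> *; apply: ler_sum => e _; apply: Ex_le_param => //; exact: decreasing_exits.
Qed.

Lemma depends_on_leaves L x :
  depends_on (touches g [set` L]) (fun w => ind R (leaves L x w)).
Proof.
apply: depends_on_indic => w w' ww' [v vL h]; exists v => //.
by rewrite -(eq_open_edges ww').
Qed.

Lemma leaves_le L x w w' : (forall e, w' e -> w e) -> leaves L x w -> leaves L x w'.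
Proof.
move=> ww' [v vL h]; exists v => //.
by apply: conn_mono h; apply: open_edges_mono => // e' _ /ww'.
Qed.

Definition locked L w : {fset V} := [fset x in L | `[< ~ leaves L x w >]]%fset.

Lemma lockedP L w x : x \in locked L w <-> x \in L /\ ~ leaves L x w.
Proof.
by rewrite !inE /=; split=> [/andP[? /asboolP]|[-> /asboolP]].
Qed.

Lemma locked_sub L w : (locked L w `<=` L)%fset.
Proof. exact: fset_sub. Qed.

(** Exploring from outside: a path from a vertex outside [locked L w] to the
    complement of [L] never meets [locked L w], so the edges with both endpoints
    in this set are not looked at. *)
Lemma locked_eq L w w' : 
  (forall e, ~ inside g [set` locked L w] e -> w e = w' e) ->
  locked L w' = locked L w.
Proof.
set S := locked L w => ww'.
have SL : forall x, x \in S -> x \in L by apply/fsubsetP; exact: locked_sub.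
have tail b v : v \notin L -> b \notin S ->
    conn g (open_edges (touches g [set` L]) w `\` touches g [set` S]) b v ->
    conn g (open_edges (touches g [set` L]) w') b v.
  move=> vL bS; apply: conn_mono => e [[eL /= we] eS]; split => //=.
  by rewrite -ww'// => /inside_touches.
apply/eqP; rewrite eqEfsubset; apply/andP; split; apply/fsubsetP => x.
- move=> /lockedP[xL xw']; apply/lockedP; split=> // xw; apply: xw'.
  have xS : x \notin S by apply/negP => /lockedP[].
  have [v vL xv] := xw; exists v => //.
  case: (last_exit [set` S] xv) => [/= /SL|/tail|[a [b [e [/= aS bS [eL we] ab h]]]]].
  + by rewrite (negbTE vL).
  + exact.
  + have /lockedP[aL []] := aS; exists v => //; apply: conn_trans (conn1 _ ab) _ => //.
    by apply: conn_mono h; exact: subDsetl.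
- move=> xS; apply/lockedP; split; first exact: SL.
  move=> [v vL xv].
  case: (last_exit [set` S] xv) => [/= /SL|h|[a [b [e [/= aS /negP bS [eL we] ab h]]]]].
  + by rewrite (negbTE vL).
  + have := xS => /lockedP[xL []]; exists v => //.
    apply: conn_mono h => e [[eL /= we] eS]; split => //=.
    by rewrite ww'// => /inside_touches.
  + have /lockedP[aL []] := aS; exists v => //.
    have nin : ~ inside g [set` S] e.
      by move=> [c [d [cS dS cd]]]; move/negP: bS; case: (link_ends ab cd) => -[? ?]; subst.
    apply: (@conn_trans _ _ _ _ _ b).
      by apply: conn1 ab; split=> //=; rewrite ww'.
    apply: conn_mono h => e' [[eL' /= we'] eS]; split => //=.
    by rewrite ww'// => /inside_touches.
Qed.

(** The outer endpoint of [e] is joined to the complement of [L], so opening [e]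
    joins [o] to it as well; closing edges keeps [o] locked. *)
Lemma exits_pivotal L w e : o \in locked L w -> exits (locked L w) o w e ->
  leaves L o (upd w e false) /\ ~ leaves L o (upd w e true).
Proof.
move=> oS [a [b [aS bS ab h]]]; have /lockedP[oL now] := oS; split; last first.
  move=> /(leaves_le (w' := w)) => /(_ _)/now; apply.
  by move=> e'; rewrite /upd; case: eqP.
have SL : forall x, x \in locked L w -> x \in L by apply/fsubsetP; exact: locked_sub.
have ew A : open_edges A w `<=` open_edges A (upd w e false).
  by apply: open_edges_mono => // e' _; rewrite /upd; case: eqP.
have oa : conn g (open_edges (touches g [set` L]) (upd w e false)) o a.
  apply: conn_mono h; apply: subset_trans (ew _) => e' [h1 h2]; split=> //.
  by apply: touches_mono (inside_touches h1) => x /SL.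
have ob : conn g (open_edges (touches g [set` L]) (upd w e false)) o b.
  apply: (conn_step oa _ ab); split; last by rewrite /= upd_same.
  by exists a, b; split=> //; exact: SL aS.
have [bL|bL] := boolP (b \in L); last by exists b.
have : leaves L b w by apply: contrapT => bw; case/negP: bS; apply/lockedP.
by move=> [v vL bv]; exists v => //; apply: conn_trans ob _; apply: conn_mono bv.
Qed.

(** The inequality of Duminil-Copin and Tassion.  Condition on the set [S] of the
    vertices of [L] that are cut off from the complement of [L].  The edges inside
    [S] are then still independent, so that the expected number of edges leading
    out of the cluster of [o] in [S], all of which are closed and pivotal, is at
    least 1 whenever [o] is in [S], that is, on the event that [o] is cut off. *)
Lemma leaves_derivative q L : 0 <= q <= 1 -> o \in L ->
  (forall S, (S `<=` L)%fset -> o \in S -> 1 <= exit_rate q S o) ->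
  1 - Ex q (star g L) (fun w => ind R (leaves L o w)) xpredT <=
  \sum_(e <- star g L) Ex q (star g L) (fun w =>
     ind R (leaves L o (upd w e false)) - ind R (leaves L o (upd w e true))) xpredT.
Proof.
move=> /andP[q0 q1] oL rate.
pose s := star g L.
have step1 w e : ind R (o \in locked L w) * ind R (exits (locked L w) o w e) <=
    ind R (leaves L o (upd w e false)) - ind R (leaves L o (upd w e true)).
  have mono : ind R (leaves L o (upd w e true)) <= ind R (leaves L o (upd w e false)).
    by apply: ind_le; apply: leaves_le => e'; rewrite /upd; case: eqP.
  case: (pselect (o \in locked L w)) => oS; last first.
    by rewrite (ind_false _ oS) mul0r subr_ge0.
  case: (pselect (exits (locked L w) o w e)) => ex; last first.
    by rewrite (ind_false _ ex) mulr0 subr_ge0.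
  have [h1 h2] := exits_pivotal oS ex.
  by rewrite (ind_true _ oS) (ind_true _ ex) (ind_true _ h1) (ind_false _ h2) subr0 mulr1.
apply: (@le_trans _ _ (\sum_(e <- s) Ex q s (fun w =>
    ind R (o \in locked L w) * ind R (exits (locked L w) o w e)) xpredT)); last first.
  by apply: ler_sum => e _; apply: le_Ex.
have step2 e : Ex q s (fun w =>
      ind R (o \in locked L w) * ind R (exits (locked L w) o w e)) xpredT =
    \sum_(S <- fpowerset L) ind R (o \in S) *
      (Ex q s (fun w => ind R (locked L w = S)) xpredT *
       Ex q s (fun w => ind R (exits S o w e)) xpredT).
  transitivity (Ex q s (fun w => \sum_(S <- fpowerset L) ind R (o \in S) *
     (ind R (locked L w = S) * ind R (exits S o w e))) xpredT).
    apply: eq_Ex => w; rewrite -[LHS](big_value (X := L)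
      (fun S => ind R (o \in S) * ind R (exits S o w e)) (locked_sub L w)).
    by apply: eq_bigr => S _; rewrite mulrCA.
  rewrite Ex_sum; apply: eq_bigr => S _; rewrite ExZ; congr (_ * _).
  apply: (Ex_mul _ _ _ (A := ~` inside g [set` S])); last first.
    by rewrite setCK; exact: depends_on_exits.
  by apply: depends_on_indic => w w' ww' wS; rewrite -wS; apply: locked_eq; rewrite wS.
under eq_bigr => e _ do rewrite step2.
rewrite exchange_big /=.
have -> : 1 - Ex q s (fun w => ind R (leaves L o w)) xpredT =
    \sum_(S <- fpowerset L) ind R (o \in S) * Ex q s (fun w => ind R (locked L w = S)) xpredT.
  rewrite -{1}(Ex_cst q s 1 xpredT) -ExB.
  under [RHS]eq_bigr => S _ do rewrite -ExZ.
  rewrite -Ex_sum; apply: eq_Ex => w.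
  under eq_bigr => S _ do rewrite mulrC.
  rewrite (big_value (fun S => ind R (o \in S)) (locked_sub L w)) -ind_not.
  by apply: ind_eqv; split=> [h|/lockedP[]//]; apply/lockedP.
rewrite !(big_seq _ _ (fpowerset L)).
apply: ler_sum => S; rewrite fpowersetE => SL.
rewrite -mulr_sumr -mulr_sumr.
case: (pselect (o \in S)) => oS; last by rewrite (ind_false _ oS) !mul0r.
rewrite ind_true// !mul1r -[leLHS]mulr1; apply: ler_wpM2l.
  by apply: Ex_ge0 => // w; exact: ind_ge0.
apply: le_trans (rate S SL oS) _.
have -> : exit_rate q S o =
    \sum_(e <- star g S) Ex q s (fun w => ind R (exits S o w e)) xpredT.
  apply: eq_bigr => e _; apply/esym/Ex_star => //.
  by apply: depends_on_sub (@depends_on_exits S o e); exact: inside_touches.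
apply: ler_sum_sub; [exact: star_uniq|exact: star_mono|].
by move=> e; apply: Ex_ge0 => // w; exact: ind_ge0.
Qed.

(** With [th] the probability to leave [L], the inequality [1 - th <= th'] makes
    [(1 - th t) * expR t] nonincreasing in [t]. *)
Lemma leaves_lower_bound (p q : R) L : 0 <= p -> p < q -> q <= 1 -> o \in L ->
  (forall S, (S `<=` L)%fset -> o \in S -> 1 <= exit_rate p S o) ->
  1 - expR (p - q) <= Ex q (star g L) (fun w => ind R (leaves L o w)) xpredT.
Proof.
move=> p0 pq q1 oL rate.
pose th t := Ex t (star g L) (fun w => ind R (leaves L o w)) xpredT.
pose th' t := \sum_(e <- star g L) Ex t (star g L) (fun w =>
     ind R (leaves L o (upd w e false)) - ind R (leaves L o (upd w e true))) xpredT.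
have dth t : is_derive t (1 : R) th (th' t) by apply: Russo; exact: star_uniq.
pose h t := (1 - th t) * expR t.
have dh t : is_derive t (1 : R) h ((1 - th t - th' t) * expR t).
  by apply: is_derive_eq; rewrite /GRing.scale /=; ring.
have : h q <= h p.
  apply: (@ler0_derive1_le_cc _ h p q) => //; rewrite ?lexx ?(ltW pq) ?andbT//.
  - move=> x; rewrite in_itv /= => /andP[px xq].
    rewrite derive1E; have := dh x => -[_ ->].
    rewrite pmulr_lle0 ?expR_gt0// subr_le0.
    apply: leaves_derivative => //; first by rewrite (le_trans p0 (ltW px)) (le_trans (ltW xq)).
    move=> S SL oS; apply: le_trans (rate _ SL oS) _.
    by apply: exit_rate_le_param => //; [exact: ltW|exact: le_trans (ltW xq) _].
  - apply: derivable_within_continuous => x _; by have := dh x => -[].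
  - by rewrite in_itv /= lexx ltW.
  - by rewrite in_itv /= lexx ltW.
rewrite /h -ler_pdivlMr ?expR_gt0// -mulrA -expRN -expRD => le1.
have th0 : 0 <= th p.
  by apply: Ex_ge0 => //; exact: le_trans (ltW pq) _.
rewrite lerBlDr -lerBlDl -/(th q); apply: le_trans le1 _.
by rewrite ler_piMl ?expR_ge0// gerBl.
Qed.

End Sharpness.

(** * Exponential moments of subcritical clusters *)

Section ExponentialMoment.
Variables (R : realType) (V E : choiceType) (g : graph V E).
Implicit Types (S C : {fset V}) (w : E -> bool) (s : seq E) (Y vs : seq V).

Lemma eq_Ex_off (q : R) s f f' w :
  (forall w', (forall e, e \notin s -> w' e = w e) -> f w' = f' w') ->
  Ex q s f w = Ex q s f' w.
Proof.
elim: s w => [|e s IH] w ff' /=; first exact: ff'.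
by congr (_ * _ + _ * _); apply: IH => w' w'w; apply: ff' => e';
  rewrite inE negb_or => /andP[ne es']; rewrite w'w// upd_other.
Qed.

Lemma Ex_base (q : R) s A f w w' : depends_on A f -> A `<=` [set` s] ->
  Ex q s f w = Ex q s f w'.
Proof.
move=> fA As; apply: (depends_on_Ex _ fA) => e [Ae es]; exfalso; apply: es.
exact: As.
Qed.

(** Restricting to a finite window [vs] makes the count a finite sum of indicators;
    the bounds obtained do not depend on the window. *)
Definition cnt vs (U : set V) : R := \sum_(v <- vs) ind R (U v).

Lemma cnt_le vs (U U' : set V) : U `<=` U' -> cnt vs U <= cnt vs U'.
Proof. by move=> UU'; apply: ler_sum => v _; apply: ind_le; exact: UU'. Qed.

Lemma cnt_ge0 vs U : 0 <= cnt vs U.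
Proof. by apply: sumr_ge0 => v _; exact: ind_ge0. Qed.

Lemma sum_ind (I : choiceType) (r : seq I) (Q : I -> Prop) :
  \sum_(i <- r) ind R (Q i) = (count (fun i => `[< Q i >]) r)%:R.
Proof.
elim: r => [|i r IH]; first by rewrite big_nil.
by rewrite big_cons IH /= natrD.
Qed.

Lemma cnt_fset vs C : uniq vs -> cnt vs [set` C] <= (#|` C|)%:R.
Proof.
move=> uvs; rewrite /cnt sum_ind ler_nat -size_filter.
apply: uniq_leq_size; first exact: filter_uniq.
by move=> x; rewrite mem_filter => /andP[/asboolP].
Qed.

Definition cluster s Y w : set V :=
  [set v | exists2 y, y \in Y & conn g (open_edges [set` s] w) y v].

(** A path that avoids all edges at its starting point does not move. *)
Lemma conn_untouched (O : set E) (C : set V) x v :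
  conn g (O `\` touches g C) x v -> C x -> v = x.
Proof.
move=> xv Cx; elim: xv => // y z e _ -> [_ ne] xz; exfalso; apply: ne.
by exists x, z.
Qed.

Section Block.
Variables (S : {fset V}) (y : V) (s : seq E).
Hypothesis yS : y \in S.

Definition block w : {fset V} :=
  [fset x in S | `[< conn g (open_edges ([set` s] `&` inside g [set` S]) w) y x >]]%fset.

Definition leads_out C e : Prop := exists a b, [/\ a \in C, b \notin S & g e a b].

Definition outer_end C e : V :=
  xget y [set b | b \notin S /\ exists2 a, a \in C & g e a b].

Definition offspring C w : seq V :=
  [seq outer_end C e | e <- s & `[< leads_out C e >] && ~~ w e].

Definition fresh C : seq E := [seq e <- s | `[< ~ touches g [set` C] e >]].
Definition used C : seq E := [seq e <- s | `[< touches g [set` C] e >]].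

Lemma blockP w x : x \in block w <->
  x \in S /\ conn g (open_edges ([set` s] `&` inside g [set` S]) w) y x.
Proof. by rewrite !inE /=; split=> [/andP[? /asboolP]|[-> /asboolP]]. Qed.

Lemma block_sub w : (block w `<=` S)%fset.
Proof. exact: fset_sub. Qed.

Lemma mem_block w : y \in block w.
Proof. by apply/blockP; split=> //; exact: conn0. Qed.

Lemma block_step w a b e : a \in block w -> b \in S -> e \in s -> ~~ w e -> g e a b ->
  b \in block w.
Proof.
move=> /blockP[aS ya] bS es we ab; apply/blockP; split=> //.
by apply: (conn_step ya _ ab); split=> //; split=> //; exists a, b.
Qed.

(** Exploring from inside: only edges touching the block are looked at. *)
Lemma block_eq w w' : (forall e, e \in s -> touches g [set` block w] e -> w e = w' e) ->
  block w' = block w.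
Proof.
move=> ww'; apply/fsetP => x; apply/idP/idP => /blockP[xS yx].
- elim: yx xS => [|a b e ya IH [[es [c [d [/= cS dS cd]]]] we] ab] xS; first exact: mem_block.
  have aS : a \in S by case: (link_ends cd ab) => -[? ?]; subst.
  apply: (block_step (a := a)) (ab) => //; first exact: IH.
  by rewrite ww'//; exists a, b; split=> //; exact: IH.
- suff : x \in block w /\ x \in block w' by case.
  elim: yx xS => [|a b e ya IH [[es [c [d [/= cS dS cd]]]] we] ab] xS.
    by split; exact: mem_block.
  have aS : a \in S by case: (link_ends cd ab) => -[? ?]; subst.
  have [aw aw'] := IH aS; split; first exact: (block_step aw xS es we ab).
  by apply: (block_step aw' xS es _ ab); rewrite -ww'//; exists a, b.
Qed.

Lemma leads_out_touches C e : leads_out C e -> touches g [set` C] e.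
Proof. by move=> [a [b [aC bS ab]]]; exists a, b. Qed.

Lemma offspring_eq C w w' : (forall e, e \in s -> touches g [set` C] e -> w e = w' e) ->
  offspring C w = offspring C w'.
Proof.
move=> ww'; congr map; apply: eq_in_filter => e es.
by case: asboolP => //= /leads_out_touches /(ww' _ es) ->.
Qed.

Lemma size_offspring C w :
  size (offspring C w) = count (fun e => `[< leads_out C e /\ ~~ w e >]) s.
Proof.
rewrite size_map size_filter; apply: eq_count => e /=.
by apply/andP/asboolP => [[/asboolP]|[/asboolP]].
Qed.

Lemma size_fresh_used C : (size (fresh C) + size (used C))%N = size s.
Proof.
rewrite !size_filter -(count_predC (fun e => `[< touches g [set` C] e >]) s) addnC.
by congr addn; apply: eq_count => e /=; rewrite asbool_neg.
Qed.

Lemma size_offspring_used C w : (size (offspring C w) <= size (used C))%N.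
Proof.
rewrite size_offspring size_filter; apply: sub_count => e /asboolP[h _].
by apply/asboolP/leads_out_touches.
Qed.

Lemma size_offspring_star C w : uniq s -> (C `<=` S)%fset ->
  (size (offspring C w) <= size (star g S))%N.
Proof.
move=> us /fsubsetP CS; rewrite size_offspring -size_filter.
apply: uniq_leq_size; first exact: filter_uniq.
move=> e; rewrite mem_filter => /andP[/asboolP[[a [b [aC bS ab]]] _] _].
by apply/starP; exists a, b; split=> //; exact: CS.
Qed.

(** Cut each path at its last visit to the block: the rest is a path through edges
    not touching the block, which starts either at another seed or at the outer end
    of an open edge leading out. *)
Lemma cluster_cover Y w v : cluster s (y :: Y) w v ->
  v \in block w \/ cluster (fresh (block w)) (offspring (block w) w ++ Y) w v.
Proof.
set C := block w; move=> [x xY xv].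
have freshE : open_edges [set` s] w `\` touches g [set` C] `<=`
              open_edges [set` fresh C] w.
  move=> e [[/= es we] eC]; split=> //=; rewrite mem_filter es andbT.
  exact/asboolP.
case: (last_exit [set` C] xv) => [|h|[a [b [e [/= aC bC [/= es we] ab h]]]]]; first by left.
- move: xY; rewrite inE => /orP[/eqP xy|xY].
    left; rewrite (conn_untouched h) xy; exact: mem_block.
  right; exists x; first by rewrite mem_cat xY orbT.
  exact: conn_mono h.
- right; exists b; last exact: conn_mono h.
  have bS : b \notin S by apply/negP => bS; apply: bC; exact: (block_step aC bS es we ab).
  rewrite mem_cat; apply/orP; left; apply/mapP; exists e.
    by rewrite mem_filter we es !andbT; apply/asboolP; exists a, b.
  rewrite /outer_end; case: xgetP => [c _ [cS [d dC dc]]|/(_ b)]; last first.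
    by case; split=> //; exists a.
  by case: (link_ends ab dc) => -[? ?]; subst.
Qed.

End Block.

Section Bound.
Variables (q th K ph : R) (b D : nat) (blk : V -> {fset V}).
Hypotheses (q01 : 0 <= q <= 1) (th0 : 0 <= th) (K1 : 1 <= K).
Hypothesis blk_mem : forall x, x \in blk x.
Hypothesis blk_card : forall x, (#|` blk x| <= b)%N.
Hypothesis blk_star : forall x, (size (star g (blk x)) <= D)%N.
Hypothesis blk_rate : forall x, q * exit_rate g q (blk x) x <= ph.
Hypothesis thK : expR (th * b%:R) * (1 + (K - 1) * K ^+ D * ph) <= K.

(** Since the number of offspring is at most [D], a bound on its mean is a bound on
    the mean of [K ^+ n]. *)
Lemma pow_le_affine n : (n <= D)%N -> K ^+ n <= 1 + n%:R * ((K - 1) * K ^+ D).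
Proof.
elim: n => [|n IH] nD; first by rewrite mul0r addr0.
have KD : K ^+ n <= K ^+ D by rewrite ler_weXn2l// ltnW.
rewrite exprS; have := IH (ltnW nD).
have -> : n.+1%:R = n%:R + 1 :> R by rewrite -natr1.
have : (K - 1) * K ^+ n <= (K - 1) * K ^+ D by rewrite ler_wpM2l ?subr_ge0.
lra.
Qed.

(** An edge leading out of the block was not looked at when the block was explored,
    so it is open with probability [q] whatever the block is. *)
Lemma mean_offspring s y w0 : uniq s ->
  Ex q s (fun w => (size (offspring (blk y) y s (block (blk y) y s w) w))%:R) w0 <= ph.
Proof.
move=> us; set S := blk y; have yS : y \in S := blk_mem y.
have /andP[q0 q1] := q01.
pose f e w := ind R (leads_out S (block S y s w) e).
have fS e : depends_on ([set` s] `&` inside g [set` S]) (f e).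
  apply: depends_on_indic => w w' ww'; congr leads_out.
  apply/fsetP => x; apply/idP/idP => /blockP[xS yx]; apply/blockP; split=> //.
    by rewrite -(eq_open_edges ww').
  by rewrite (eq_open_edges ww').
have fe e : depends_on (~` [set e]) (f e).
  case: (pselect (inside g [set` S] e)) => eS.
    have f0 w : f e w = 0.
      apply: ind_false => -[a [c [/(fsubsetP (block_sub _ _ _ _)) aS cS ac]]].
      have [a' [c' [/= aS' cS' ac']]] := eS.
      by move/negP: cS; case: (link_ends ac' ac) => -[? ?]; subst.
    by move=> w w' _; rewrite !f0.
  by apply: depends_on_sub (fS e) => e' [_ eS'] /= ee'; apply: eS; rewrite -ee'.
have fle e w : f e w <= ind R (exits g S y w e).
  apply: ind_le => -[a [c [/blockP[aS ya] cS ac]]]; exists a, c; split=> //.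
  by apply: conn_mono ya; apply: open_edges_mono => //; exact: subIsetr.
have F0 e : 0 <= Ex q (star g S) (fun w => ind R (exits g S y w e)) xpredT.
  by apply: Ex_ge0 => // w; exact: ind_ge0.
have mf e : Ex q s (f e) w0 <= Ex q (star g S) (fun w => ind R (exits g S y w e)) xpredT.
  pose u := undup (s ++ star g S).
  have -> : Ex q s (f e) w0 = Ex q u (f e) w0.
    apply: (eq_Ex_on _ _ us (undup_uniq _) (fS e)) => e' [/= es _].
    by rewrite mem_undup mem_cat es.
  apply: le_trans (le_Ex q0 q1 u w0 (fle e)) _.
  have dS : depends_on (inside g [set` S]) (fun w => ind R (exits g S y w e)).
    exact: depends_on_exits.
  rewrite (eq_Ex_on _ _ (undup_uniq _) (star_uniq g S) dS); last first.
    move=> e' /inside_touches/starP es; by rewrite mem_undup mem_cat es orbT.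
  rewrite (Ex_base _ _ xpredT dS)// => e' /inside_touches h; exact/starP.
apply: le_trans (blk_rate y).
have -> : Ex q s (fun w => (size (offspring S y s (block S y s w) w))%:R) w0 =
    \sum_(e <- s) Ex q s (fun w => (~~ w e)%:R * f e w) w0.
  rewrite -Ex_sum; apply: eq_Ex => w; rewrite size_offspring -sum_ind.
  apply: eq_bigr => e _; rewrite /f /ind -natrM mulnb; congr (_%:R); congr nat_of_bool.
  by apply/asboolP/andP => [[? ?]|[? /asboolP]] //; split=> //; exact/asboolP.
rewrite /exit_rate mulr_sumr big_seq.
apply: (@le_trans _ _ (\sum_(e <- s) q *
    Ex q (star g S) (fun w => ind R (exits g S y w e)) xpredT)).
  rewrite [leRHS]big_seq; apply: ler_sum => e es.
  by rewrite (Ex_edge _ _ us es (fe e)) ler_wpM2l.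
rewrite (bigID (mem (star g S))) /= [X in _ + X]big1 ?addr0; last first.
  move=> e /negP es; rewrite (eq_Ex _ _ (g := fun=> 0)) ?Ex_cst ?mulr0// => w.
  by apply: ind_false => /exits_star.
rewrite -big_filter; apply: ler_sum_sub; first exact: filter_uniq.
  by move=> e; rewrite mem_filter => /andP[].
by move=> e; rewrite mulr_ge0.
Qed.

Lemma mean_pow_offspring s y w0 : uniq s ->
  Ex q s (fun w => K ^+ size (offspring (blk y) y s (block (blk y) y s w) w)) w0
  <= 1 + (K - 1) * K ^+ D * ph.
Proof.
move=> us; have /andP[q0 q1] := q01.
have K0 : 0 <= (K - 1) * K ^+ D.
  by rewrite mulr_ge0 ?subr_ge0// exprn_ge0// (le_trans ler01).
apply: (@le_trans _ _ (Ex q s (fun w => 1 +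
  (K - 1) * K ^+ D * (size (offspring (blk y) y s (block (blk y) y s w) w))%:R) w0)).
  apply: le_Ex => // w; rewrite [X in 1 + X]mulrC; apply: pow_le_affine.
  by apply: leq_trans (blk_star y); apply: size_offspring_star => //; exact: block_sub.
by rewrite ExD Ex_cst ExZ lerD2l ler_wpM2l// mean_offspring.
Qed.

(** Explore the block of one seed; the rest of the cluster is reached, through
    edges not yet looked at, from the outer ends of the open edges leading out
    of the explored part.  Each seed is thus replaced by at most one new seed on
    average, which pays for the bounded number of vertices explored. *)
Theorem cluster_exp_moment vs s Y w0 : uniq vs -> uniq s ->
  Ex q s (fun w => expR (th * cnt vs (cluster s Y w))) w0 <= K ^+ size Y.
Proof.
move=> uvs; have /andP[q0 q1] := q01; have K0 : 0 <= K := le_trans ler01 K1.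
have [n] := ubnP (size s + size Y); elim: n s Y w0 => // n IH s [|y Y] w0 nsY us.
  rewrite (eq_Ex _ _ (g := fun=> 1)) ?Ex_cst// => w; rewrite /cnt big1 ?mulr0 ?expR0// => v _.
  by apply: ind_false => -[].
set S := blk y; have yS : y \in S := blk_mem y.
pose G C w := expR (th * cnt vs (cluster (fresh s C) (offspring S y s C w ++ Y) w)).
have cover w : expR (th * cnt vs (cluster s (y :: Y) w)) <=
    expR (th * b%:R) * G (block S y s w) w.
  rewrite /G -expRD ler_expR -mulrDr ler_wpM2l//.
  apply: (@le_trans _ _ (cnt vs [set` block S y s w] + cnt vs (cluster
    (fresh s (block S y s w)) (offspring S y s (block S y s w) w ++ Y) w))); last first.
    rewrite lerD2r; apply: le_trans (cnt_fset _ uvs) _; rewrite ler_nat.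
    by apply: leq_trans (blk_card y); apply: fsubset_leq_card; exact: block_sub.
  rewrite /cnt -big_split; apply: ler_sum => v _ /=.
  set A := cluster _ _ _ _; set B := (v \in _); set A' := cluster _ _ _ _.
  case: (pselect A) => hA; last by rewrite (ind_false _ hA) addr_ge0 ?ind_ge0.
  rewrite (ind_true _ hA); case: (cluster_cover yS hA) => h.
    by rewrite (ind_true _ (h : B)) lerDl ind_ge0.
  by rewrite (ind_true _ (h : A')) lerDr ind_ge0.
apply: le_trans (le_Ex q0 q1 s w0 cover) _; rewrite ExZ.
(* For a fixed value [C] of the block, average first over the fresh edges. *)
have one C : Ex q s (fun w => ind R (block S y s w = C) * G C w) w0 <=
    Ex q s (fun w => ind R (block S y s w = C) *
                     K ^+ (size (offspring S y s C w) + size Y)) w0.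
  have ps : perm_eq s (used s C ++ fresh s C).
    have -> : fresh s C = [seq e <- s | predC (fun e => `[< touches g [set` C] e >]) e].
      by apply: eq_filter => e /=; exact: asbool_neg.
    by rewrite perm_sym; exact: permEl (perm_filterC _ s).
  rewrite !(Ex_perm _ _ _ ps) !Ex_cat; apply: le_Ex => // w1.
  have off w2 : (forall e, e \notin fresh s C -> w2 e = w1 e) ->
      forall e, e \in s -> touches g [set` C] e -> w2 e = w1 e.
    by move=> h e es eC; apply: h; rewrite mem_filter es andbT; apply/asboolPn.
  have indE w2 : (forall e, e \notin fresh s C -> w2 e = w1 e) ->
      ind R (block S y s w2 = C) = ind R (block S y s w1 = C).
    move=> h; apply: ind_eqv; split=> blC; rewrite -[RHS]blC; apply: block_eq => // e es;
      rewrite blC => eC; first by rewrite (off w2).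
    by rewrite (off w2).
  have offE w2 : (forall e, e \notin fresh s C -> w2 e = w1 e) ->
      offspring S y s C w2 = offspring S y s C w1.
    by move=> h; apply: offspring_eq => e es eC; exact: off.
  rewrite (eq_Ex_off _ (f' := fun w => ind R (block S y s w1 = C) *
    expR (th * cnt vs (cluster (fresh s C) (offspring S y s C w1 ++ Y) w)))); last first.
    by move=> w2 h; rewrite /G indE// offE.
  rewrite [leRHS](eq_Ex_off _ (f' := fun=> ind R (block S y s w1 = C) *
    K ^+ (size (offspring S y s C w1) + size Y))); last first.
    by move=> w2 h; rewrite indE// offE.
  rewrite Ex_cst ExZ; apply: ler_wpM2l; first exact: ind_ge0.
  rewrite -size_cat; apply: IH; last exact: filter_uniq.
  rewrite size_cat; move: nsY; rewrite /= addnS ltnS; apply: leq_ltn_trans.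
  by rewrite addnA leq_add2r -(size_fresh_used s C) leq_add2l size_offspring_used.
have sumC f : Ex q s (fun w => f (block S y s w) w) w0 =
    \sum_(C <- fpowerset S) Ex q s (fun w => ind R (block S y s w = C) * f C w) w0.
  rewrite -Ex_sum; apply: eq_Ex => w; apply/esym.
  by apply: (big_value (fun C => f C w)); exact: block_sub.
apply: (@le_trans _ _ (expR (th * b%:R) * (Ex q s (fun w =>
    K ^+ (size (offspring S y s (block S y s w) w) + size Y)) w0))).
  rewrite ler_wpM2l ?expR_ge0// (sumC G)
    (sumC (fun C w => K ^+ (size (offspring S y s C w) + size Y))).
  by apply: ler_sum => C _; exact: one.
rewrite (eq_Ex _ _ (g := fun w =>
  K ^+ size (offspring S y s (block S y s w) w) * K ^+ size Y)); last first.
  by move=> w; rewrite exprD.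
rewrite ExZr mulrA exprS ler_wpM2r ?exprn_ge0//; apply: le_trans thK.
by rewrite ler_wpM2l ?expR_ge0// mean_pow_offspring.
Qed.

End Bound.
End ExponentialMoment.

(** * Sprinkling *)

Section Sprinkling.
Variables (R : realType) (E : choiceType).
Implicit Types (s : seq E) (w : E -> bool) (f : (E -> bool) -> R).

(** The mean of [f] after each closed edge of [s] has been opened with
    probability [lam], independently. *)
Fixpoint sprinkle (lam : R) s f w : R :=
  if s is e :: s' then
    if w e then lam * sprinkle lam s' f (upd w e false) + (1 - lam) * sprinkle lam s' f w
    else sprinkle lam s' f w
  else f w.

Lemma Ex_sprinkle (p lam : R) s f w : uniq s ->
  Ex p s (sprinkle lam s f) w = Ex (p + (1 - p) * lam) s f w.
Proof.
elim: s w => //= e s IH w /andP[es us].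
have h0 : Ex p s (fun w => if w e then lam * sprinkle lam s f (upd w e false) +
      (1 - lam) * sprinkle lam s f w else sprinkle lam s f w) (upd w e false) =
    Ex p s (sprinkle lam s f) (upd w e false).
  by apply: eq_Ex_off => w' h; rewrite (h e es) upd_same.
have h1 : Ex p s (fun w => if w e then lam * sprinkle lam s f (upd w e false) +
      (1 - lam) * sprinkle lam s f w else sprinkle lam s f w) (upd w e true) =
    lam * Ex p s (sprinkle lam s f) (upd w e false) +
    (1 - lam) * Ex p s (sprinkle lam s f) (upd w e true).
  rewrite (eq_Ex_off _ (f' := fun w => lam * sprinkle lam s f (upd w e false) +
      (1 - lam) * sprinkle lam s f w)); last by move=> w' h; rewrite (h e es) upd_same.
  by rewrite ExD !ExZ (Ex_upd p (sprinkle lam s f))// upd_upd.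
by rewrite h0 h1 !IH//; ring.
Qed.

Lemma sprinkle_ge0 lam s f w : 0 <= lam <= 1 -> (forall w, 0 <= f w) ->
  0 <= sprinkle lam s f w.
Proof.
move=> /andP[l0 l1] f0; elim: s w => //= e s IH w; case: ifP => // _.
by rewrite addr_ge0// mulr_ge0// subr_ge0.
Qed.

Definition open_also s (F : pred E) w : E -> bool := fun e => w e && ~~ ((e \in s) && F e).

(** Keep only the event that all closed edges of [F] get opened; opening further
    edges does not decrease [f]. *)
Lemma sprinkle_ge lam s (F : pred E) f w : 0 <= lam <= 1 -> (forall w, 0 <= f w) ->
  decreasing f -> uniq s ->
  lam ^+ count (predI F w) s * f (open_also s F w) <= sprinkle lam s f w.
Proof.
move=> l01 f0 df; have /andP[l0 l1] := l01.
elim: s w => [|e s IH] w /=.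
  by move=> _; rewrite expr0 mul1r; apply: df => e; rewrite /open_also in_nil andbT.
move=> /andP[es us].
have cnt0 b : count (predI F (upd w e b)) s = count (predI F w) s.
  apply: eq_in_count => e' es' /=; rewrite upd_other//.
  by apply: contraNneq es => <-.
have cle (c : R) n x y : x <= y -> lam ^+ n * x <= lam ^+ n * y.
  by move=> xy; rewrite ler_wpM2l// exprn_ge0.
have IH0 := IH (upd w e false) us; have IH1 := IH w us.
rewrite cnt0 in IH0.
case we: (w e); last first.
  rewrite andbF add0n; apply: le_trans IH1; apply: (cle 0); apply: df => e'.
  rewrite /open_also inE; case: eqVneq => [->|//].
  by rewrite we.
have [Fe|nFe] := boolP (F e); rewrite ?andTb ?andFb ?add0n.
  rewrite add1n exprS -mulrA; apply: le_trans (_ : _ <= lam * sprinkle lam s f (upd w e false)) _.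
    rewrite ler_wpM2l//; apply: le_trans IH0; apply: (cle 0); apply: df => e'.
    rewrite /open_also inE /upd; case: eqVneq => [->|//] //=.
  by rewrite lerDl mulr_ge0 ?sprinkle_ge0 ?subr_ge0.
have h0 : lam ^+ count (predI F w) s * f (open_also (e :: s) F w) <=
    sprinkle lam s f (upd w e false).
  apply: le_trans IH0; apply: (cle 0); apply: df => e'.
  by rewrite /open_also inE /upd; case: eqVneq => [->|//] //=.
have h1 : lam ^+ count (predI F w) s * f (open_also (e :: s) F w) <= sprinkle lam s f w.
  apply: le_trans IH1; apply: (cle 0); apply: df => e'.
  rewrite /open_also inE; case: eqVneq => [->|//] /=.
  by rewrite (negbTE nFe) !andbF.
set a := lam ^+ _ * _ in h0 h1 *; nra.
Qed.

End Sprinkling.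

Section Animals.
Variables (R : realType) (V E : choiceType) (g : graph V E) (o : V).
Variables (p lam th K : R) (s : seq E) (vs : seq V).
Hypotheses (p01 : 0 <= p <= 1) (lam0 : 0 < lam) (lam1 : lam <= 1) (th0 : 0 < th).
Hypothesis us : uniq s.
Hypothesis moment : Ex (p + (1 - p) * lam) s
  (fun w => expR (th * cnt R vs (cluster g s [:: o] w))) xpredT <= K.

Variables (U : (E -> bool) -> set V) (F : (E -> bool) -> set E).
Hypothesis U_conn : forall w v, U w v ->
  conn g ([set` s] `&` ([set e | ~~ w e] `|` F w)) o v.

(** A random connected set becomes part of an open cluster once the closed edges
    that hold it together are opened.  The price of a sprinkling that opens [N]
    given edges is [lam ^+ N], whence a bound on the exponential moment of
    [th * cnt vs U - ln lam^-1 * N], and on its mean by convexity. *)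
Lemma mean_animal :
  th * Ex p s (fun w => cnt R vs (U w)) xpredT <=
  K - ln lam * Ex p s (fun w => \sum_(e <- s) ind R (F w e /\ w e)) xpredT.
Proof.
have /andP[p0 p1] := p01.
rewrite -ExZ -[leLHS]addr0.
suff : Ex p s (fun w => th * cnt R vs (U w) +
    ln lam * \sum_(e <- s) ind R (F w e /\ w e)) xpredT <= K.
  by rewrite ExD [X in _ + X]ExZ; lra.
apply: le_trans moment; rewrite -Ex_sprinkle//; apply: le_Ex => // w.
pose f w := expR (th * cnt R vs (cluster g s [:: o] w)).
have df : decreasing f.
  move=> w1 w2 ww; rewrite ler_expR ler_wpM2l ?(ltW th0)//; apply: cnt_le => v [y yo yv].
  by exists y => //; apply: conn_mono yv; apply: open_edges_mono => // e _ /ww.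
have := @sprinkle_ge R E lam s (fun e => `[< F w e >]) f w _ (fun=> expR_ge0 _) df us.
rewrite (ltW lam0) lam1 => /(_ isT); apply: le_trans.
set N := count _ _.
have -> : \sum_(e <- s) ind R (F w e /\ w e) = N%:R.
  rewrite sum_ind; congr (_%:R); apply: eq_count => e /=.
  by apply/asboolP/andP => [[/asboolP ? ?]|[/asboolP ? ?]].
have -> : lam ^+ N = expR (ln lam * N%:R).
  by rewrite -{1}(lnK (x := lam)) ?posrE// -expRM_natr.
rewrite /f -expRD addrC.
apply: (@le_trans _ _ (1 + (ln lam * N%:R + th * cnt R vs (U w)))); first by rewrite lerDr.
apply: le_trans (expR_ge1Dx _) _; rewrite ler_expR lerD2l ler_wpM2l ?(ltW th0)//.
apply: cnt_le => v /U_conn ov; exists o; first by rewrite mem_head.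
apply: conn_mono ov => e [/= es h]; split=> //=; rewrite /open_also es /=.
by case: h => [/negbTE ->//|/asboolP ->]; rewrite andbF.
Qed.

End Animals.

(** * Routes in a finite graph *)

Section Routes.
Variables (R : realType) (V E : choiceType) (g : graph V E) (o : V).
Implicit Types (st : seq (E * V)) (w : E -> bool) (e : E) (x v : V).

Fixpoint walk x st : bool :=
  if st is (e, y) :: st' then g e x y && walk y st' else true.

Definition time w st : nat := \sum_(a <- st) nat_of_bool (w a.1).

Lemma time_cons w a st : time w (a :: st) = (w a.1 + time w st)%N.
Proof. exact: big_cons. Qed.

Lemma time_size w st : (time w st <= size st)%N.
Proof. by elim: st => [|a st IH]; rewrite ?/time ?big_nil// big_cons /= -add1n leq_add// leq_b1. Qed.

Lemma time_le w w' st : (forall e, w e -> w' e) -> (time w st <= time w' st)%N.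
Proof. by move=> ww'; apply: leq_sum => a _; case: (w a.1) (ww' a.1) => // ->. Qed.

Lemma time_eq w w' st : {in unzip1 st, w =1 w'} -> time w st = time w' st.
Proof. by move=> ww'; rewrite /time !big_seq; apply: eq_bigr => a ast; rewrite ww'// map_f. Qed.

Lemma time_open w st e : w e -> e \in unzip1 st -> (time (upd w e false) st < time w st)%N.
Proof.
move=> we; have le st' : (time (upd w e false) st' <= time w st')%N.
  by apply: time_le => e'; rewrite /upd; case: eqP.
elim: st => // a st IH; rewrite !time_cons inE => /orP[/eqP <-|/IH h].
  by rewrite upd_same we add0n add1n ltnS.
rewrite -addnS leq_add//; rewrite /upd; case: eqP => // _; exact: leq0n.
Qed.

Lemma walk_conn (O : set E) x st v : walk x st -> [set` unzip1 st] `<=` O ->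
  v \in x :: unzip2 st -> conn g O x v.
Proof.
elim: st x => [|[e y] st IH] x /=; first by rewrite inE => _ _ /eqP ->; exact: conn0.
move=> /andP[xy yst] sO; rewrite inE => /orP[/eqP ->|vst]; first exact: conn0.
apply: conn_trans (conn1 (sO e _) xy) _; first by rewrite /= mem_head.
by apply: IH => // e' /= e's; apply: sO; rewrite /= inE e's orbT.
Qed.

Lemma walk_ends x st e a b : walk x st -> e \in unzip1 st -> g e a b ->
  a \in x :: unzip2 st.
Proof.
elim: st x => [|[e' y] st IH] x //= /andP[xy yst].
rewrite inE => /orP[/eqP ee'|est] ab; last by rewrite inE (IH y)// orbT.
rewrite ee' in ab.
by case: (link_ends xy ab) => -[-> _]; rewrite !inE eqxx ?orbT.
Qed.

Variables (s : seq E) (A : set V) (L : nat).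
Hypothesis us : uniq s.

Definition admissible st := [/\ walk o st, A (last o (unzip2 st)) & {subset unzip1 st <= s}].

Definition route w st :=
  admissible st /\ forall st', admissible st' -> (time w st <= time w st')%N.

Definition on_route w : set E := [set e | exists2 st, route w st & e \in unzip1 st].

Definition route_points w : set V :=
  [set v | exists2 st, route w st & v \in o :: unzip2 st].

(** Passage times never exceed [L]. *)
Hypothesis short : exists2 st, admissible st & (size st <= L)%N.

Definition opt w : seq (E * V) := xget [::] (route w).

Lemma optP w : route w (opt w).
Proof.
have ex : exists n, `[< exists2 st, admissible st & time w st = n >].
  by case: short => st ast _; exists (time w st); apply/asboolP; exists st.
case: (ex_minnP ex) => m /asboolP[st ast tm] min.
apply: xgetPex; exists st; split=> // st' ast'; rewrite tm; apply: min.
by apply/asboolP; exists st'.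
Qed.

Definition mintime w := time w (opt w).

Lemma mintime_le w st : admissible st -> (mintime w <= time w st)%N.
Proof. by have [_] := optP w; apply. Qed.

Lemma mintime_size w : (mintime w <= L)%N.
Proof.
case: short => st ast stL; apply: leq_trans (mintime_le w ast) _.
exact: leq_trans (time_size w st) stL.
Qed.

Lemma mintime_mono w w' : (forall e, w e -> w' e) -> (mintime w <= mintime w')%N.
Proof.
move=> ww'; apply: leq_trans (mintime_le w (optP w').1) _; exact: time_le.
Qed.

Definition pivotal e w := mintime (upd w e true) <> mintime (upd w e false).

(** Opening a closed edge of a route makes this route strictly faster. *)
Lemma on_route_pivotal w e : w e -> on_route w e -> pivotal e w.
Proof.
move=> we [st [ast sto] est].
rewrite /pivotal; have -> : upd w e true = w.
  by apply/funext => e'; rewrite /upd; case: eqP => // ->; rewrite we.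
apply/eqP; rewrite gtn_eqF//; apply: leq_ltn_trans (mintime_le _ ast) _.
by apply: leq_trans (time_open we est) (sto _ (optP w).1).
Qed.

(** Closing an open pivotal edge slows down all routes. *)
Lemma pivotal_opt w e : ~~ w e -> pivotal e w -> e \in unzip1 (opt w).
Proof.
move=> we; apply: contra_notT => eo.
have w0 : upd w e false = w.
  by apply/funext => e'; rewrite /upd; case: eqP => // ->; apply/esym/negbTE.
rewrite w0; apply/eqP; rewrite eqn_leq; apply/andP; split.
  apply: leq_trans (mintime_le _ (optP w).1) _.
  rewrite (time_eq (w' := w))// => e' e'o; rewrite upd_other//.
  by apply: contraNneq eo => <-.
by apply: mintime_mono => e'; rewrite /upd; case: eqP.
Qed.

Lemma depends_on_pivotal e : depends_on (~` [set e]) (fun w => ind R (pivotal e w)).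
Proof.
apply: depends_on_indic => w w' ww'; rewrite /pivotal.
have h b : upd w e b = upd w' e b.
  by apply/funext => e'; rewrite /upd; case: eqP => // ne; exact: ww'.
by rewrite !h.
Qed.

Variables (p lam th K : R) (D : nat) (vs : seq V).
Hypotheses (p0 : 0 < p) (p1 : p <= 1) (lam0 : 0 < lam) (lam1 : lam <= 1) (th0 : 0 < th).
Hypothesis moment : Ex (p + (1 - p) * lam) s
  (fun w => expR (th * cnt R vs (cluster g s [:: o] w))) xpredT <= K.
Hypothesis deg : forall v, (size (star g [fset v]%fset) <= D)%N.
Hypothesis vs_s : forall e, e \in s -> exists2 v, v \in vs & exists y, g e v y.

Let kap : R := - ln lam.

Let kap0 : 0 <= kap.
Proof. by rewrite oppr_ge0 ln_le0. Qed.

Let p01 : 0 <= p <= 1. Proof. by rewrite ltW. Qed.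

(** The animal consisting of one route is held together by at most [L] closed
    edges. *)
Lemma mean_opt_points :
  Ex p s (fun w => cnt R vs [set` o :: unzip2 (opt w)]) xpredT <= (K + kap * L%:R) / th.
Proof.
rewrite ler_pdivlMr// mulrC.
have := @mean_animal R V E g o p lam th K s vs p01 lam0 lam1 th0 us moment
  (fun w => [set` o :: unzip2 (opt w)]) (fun w => [set` unzip1 (opt w)]).
move=> h; apply: le_trans (h _) _.
  move=> w v vo; have [[wo _ so] _] := optP w.
  by apply: (walk_conn wo) vo => e eo; split; [exact: so|right].
rewrite lerD2l -mulNr ler_wpM2l// -(Ex_cst p s L%:R xpredT).
apply: le_Ex => // [|w]; first exact: ltW.
rewrite sum_ind ler_nat; apply: leq_trans (mintime_size w).
rewrite /mintime -size_filter.
apply: (@leq_trans (count w (undup (unzip1 (opt w))))).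
  rewrite -size_filter; apply: uniq_leq_size; first exact: filter_uniq.
  move=> e; rewrite mem_filter => /andP[/asboolP[/= eo we] _].
  by rewrite mem_filter we mem_undup.
rewrite -size_filter; apply: (@leq_trans (size [seq e <- unzip1 (opt w) | w e])).
  apply: size_subseq; have -> : [seq e <- undup (unzip1 (opt w)) | w e] =
    undup [seq e <- unzip1 (opt w) | w e] by rewrite filter_undup.
  exact: undup_subseq.
rewrite size_filter /time count_map.
by elim: (opt w) => [|a st IH]; rewrite ?big_nil// big_cons /= leq_add2l.
Qed.

Lemma mean_opt_edges :
  Ex p s (fun w => \sum_(e <- s) ind R (e \in unzip1 (opt w))) xpredT <=
  D%:R * ((K + kap * L%:R) / th).
Proof.
have D0 : 0 <= D%:R :> R by exact: ler0n.
apply: le_trans (ler_wpM2l D0 mean_opt_points); rewrite -ExZ.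
apply: le_Ex => // [|w]; first exact: ltW.
pose h e v := ind R (exists y, g e v y).
apply: (@le_trans _ _ (\sum_(e <- s) \sum_(v <- vs)
    h e v * ind R ([set` o :: unzip2 (opt w)] v))).
  rewrite !big_seq; apply: ler_sum => e /vs_s[v vvs [y vy]].
  case: (pselect (e \in unzip1 (opt w))) => eo; last first.
    by rewrite ind_false// sumr_ge0// => u _; rewrite mulr_ge0 ?ind_ge0.
  rewrite ind_true// (big_rem v)//= /h ind_true; last by exists y.
  have [[wo _ _] _] := optP w.
  rewrite ind_true /=; last exact: walk_ends wo eo vy.
  by rewrite mulr1 lerDl sumr_ge0// => u _; rewrite mulr_ge0 ?ind_ge0.
rewrite exchange_big /cnt mulr_sumr; apply: ler_sum => v _ /=.
rewrite -mulr_suml ler_wpM2r ?ind_ge0//.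
rewrite /h sum_ind ler_nat; apply: leq_trans (deg v); rewrite -size_filter.
apply: uniq_leq_size; first exact: filter_uniq.
move=> e; rewrite mem_filter => /andP[/asboolP[y vy] _].
by apply/starP; exists v, y; split=> //=; rewrite inE.
Qed.

(** Being pivotal does not depend on the state of the edge, so closed and open
    pivotal edges are in proportion [1 - p] to [p]. *)
Lemma mean_closed_on_route :
  Ex p s (fun w => \sum_(e <- s) ind R (on_route w e /\ w e)) xpredT <=
  (1 - p) / p * (D%:R * ((K + kap * L%:R) / th)).
Proof.
have q0 : 0 <= (1 - p) / p by rewrite divr_ge0 ?subr_ge0// ltW.
apply: le_trans (ler_wpM2l q0 mean_opt_edges).
rewrite !Ex_sum mulr_sumr !big_seq; apply: ler_sum => e es.
apply: (@le_trans _ _ (Ex p s (fun w => (w e)%:R * ind R (pivotal e w)) xpredT)).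
  apply: le_Ex => // [|w]; first exact: ltW.
  case: (pselect (on_route w e /\ w e)) => [[ew we]|h].
    by rewrite we !ind_true ?mulr1//; exact: on_route_pivotal.
  by rewrite ind_false// mulr_ge0 ?ind_ge0.
have [open closed] := Ex_edge p xpredT us es (@depends_on_pivotal e).
rewrite closed.
have -> : (1 - p) * Ex p s (fun w => ind R (pivotal e w)) xpredT =
    (1 - p) / p * (p * Ex p s (fun w => ind R (pivotal e w)) xpredT).
  by rewrite mulrA divfK// gt_eqF.
rewrite -open ler_wpM2l//; apply: le_Ex => // [|w]; first exact: ltW.
case: (boolP (w e)) => we; first by rewrite mul0r ind_ge0.
by rewrite mul1r; apply: ind_le; exact: pivotal_opt.
Qed.

(** The animal consisting of all routes is held together by the closed edges that
    lie on some route. *)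
Lemma mean_route_points :
  Ex p s (fun w => cnt R vs (route_points w)) xpredT <=
  (K + kap * ((1 - p) / p * (D%:R * ((K + kap * L%:R) / th)))) / th.
Proof.
rewrite ler_pdivlMr// mulrC.
have := @mean_animal R V E g o p lam th K s vs p01 lam0 lam1 th0 us moment
  route_points on_route.
move=> h; apply: le_trans (h _) _.
  move=> w v [st rst vst]; have [[wst _ sst] _] := rst.
  by apply: (walk_conn wst) vst => e est; split; [exact: sst|right; exists st].
by rewrite lerD2l -mulNr ler_wpM2l// mean_closed_on_route.
Qed.

End Routes.

(** * Graph automorphisms *)

Section Automorphism.
Variables (R : realType) (V E : choiceType) (g : graph V E).
Variables (f f' : V -> V) (h h' : E -> E).
Hypotheses (fK : cancel f f') (fK' : cancel f' f) (hK : cancel h h') (hK' : cancel h' h).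
Hypothesis aut : forall e x y, g (h e) (f x) (f y) = g e x y.
Implicit Types (S : {fset V}) (w : E -> bool).

Lemma Ex_map (q : R) s F w :
  Ex q (map h s) F w = Ex q s (fun w' => F (w' \o h')) (w \o h).
Proof.
elim: s w => [|e s IH] w /=.
  by congr F; apply/funext => e /=; rewrite hK'.
have u b : upd w (h e) b \o h = upd (w \o h) e b.
  by apply/funext => e' /=; rewrite /upd (can_eq hK).
by rewrite !IH !u.
Qed.

Lemma star_aut S : perm_eq (star g (f @` S)%fset) (map h (star g S)).
Proof.
apply: uniq_perm; first exact: star_uniq.
  by rewrite map_inj_uniq ?star_uniq//; exact: can_inj hK.
move=> e; apply/idP/mapP.
  move=> /starP[x [y [/= /imfsetP[/= z zS ->] exy]]]; exists (h' e); last by rewrite hK'.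
  by apply/starP; exists z, (f' y); split=> //; rewrite -aut hK' fK'.
move=> [e' /starP[x [y [/= xS exy]]] ->]; apply/starP.
by exists (f x), (f y); split; rewrite ?aut//=; apply/imfsetP; exists x.
Qed.

Lemma size_star_aut S : size (star g (f @` S)%fset) = size (star g S).
Proof. by rewrite (perm_size (star_aut S)) size_map. Qed.

Lemma mem_aut S x : (f x \in (f @` S)%fset) = (x \in S).
Proof.
apply/imfsetP/idP => [[/= y yS /(can_inj fK) -> //]|xS]; by exists x.
Qed.

Lemma conn_aut (O O' : set E) x y : (forall e, O e -> O' (h e)) ->
  conn g O x y -> conn g O' (f x) (f y).
Proof.
move=> OO'; elim=> [|a b e _ IH /OO' Oe ab]; first exact: conn0.
by apply: (conn_step IH Oe); rewrite aut.
Qed.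

Lemma exits_aut S x w e : exits g S x w e -> exits g (f @` S)%fset (f x) (w \o h') (h e).
Proof.
move=> [a [b [aS bS ab xa]]]; exists (f a), (f b); split; rewrite ?mem_aut ?aut//.
apply: conn_aut xa => e' [[c [c' [/= cS cS' cc']]] we']; split; last by rewrite /= hK.
by exists (f c), (f c'); rewrite /= !mem_aut aut.
Qed.

End Automorphism.

Lemma exit_rate_aut (R : realType) (V E : choiceType) (g : graph V E)
    (f f' : V -> V) (h h' : E -> E) (q : R) S x :
  cancel f f' -> cancel f' f -> cancel h h' -> cancel h' h ->
  (forall e x y, g (h e) (f x) (f y) = g e x y) ->
  exit_rate g q (f @` S)%fset (f x) = exit_rate g q S x.
Proof.
move=> fK fK' hK hK' aut.
have aut' e a b : g (h' e) (f' a) (f' b) = g e a b by rewrite -aut hK' !fK'.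
have imK : ((f' @` (f @` S)) = S)%fset.
  apply/fsetP => y; rewrite -{1}(fK y) (mem_aut fK') (mem_aut fK)//.
rewrite /exit_rate (perm_big _ (star_aut fK' hK hK' aut S)) big_map.
apply: eq_bigr => e _; rewrite (Ex_perm _ _ _ (star_aut fK' hK hK' aut S)).
rewrite (Ex_map hK hK'); apply: eq_Ex => w; apply: ind_eqv; split; last exact: exits_aut.
move=> /(exits_aut fK' hK' aut'); rewrite imK fK hK.
by congr (exits _ _ _ _ _); apply/funext => e' /=; rewrite hK.
Qed.

Section Constants.
Variable R : realType.

(** For [K] close to 1 one has [K ^+ D * ph <= r] with [r < 1], so the second factor
    is at most [1 + (K - 1) * r < K], and a small [th] fits in the gap. *)
Lemma exp_moment_constants (ph : R) (b D : nat) : 0 < ph -> ph < 1 ->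
  exists th K : R, [/\ 0 < th, 1 <= K &
    expR (th * b%:R) * (1 + (K - 1) * K ^+ D * ph) <= K].
Proof.
move=> ph0 ph1; pose r := (1 + ph) / 2.
have r0 : 0 < r by rewrite /r; lra.
have r1 : r < 1 by rewrite /r; lra.
have phr : ph < r by rewrite /r; lra.
pose de := ln (r / ph) / D.+1%:R.
have l0 : 0 < ln (r / ph) by rewrite ln_gt0// ltr_pdivlMr// mul1r.
have de0 : 0 < de by rewrite divr_gt0.
pose K := 1 + de.
have KD : K ^+ D * ph <= r.
  rewrite -ler_pdivlMr// -[leRHS]lnK ?posrE ?(divr_gt0 r0 ph0)//.
  apply: (@le_trans _ _ (expR de ^+ D)).
    by rewrite lerXn2r ?nnegrE ?expR_ge0 ?expR_ge1Dx// /K addr_ge0// ltW.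
  rewrite -expRM_natl ler_expR /de mulrCA -[leRHS]mulr1 ler_wpM2l ?(ltW l0)//.
  by rewrite ler_pdivrMr// mul1r ler_nat.
have K1 : 1 < K by rewrite ltrDl.
pose M := 1 + (K - 1) * r.
have M0 : 0 < M by rewrite /M /K; nra.
have MK : 1 < K / M by rewrite ltr_pdivlMr// mul1r /M /K; nra.
pose th := ln (K / M) / b.+1%:R.
have t0 : 0 < ln (K / M) by rewrite ln_gt0.
exists th, K; split; [by rewrite divr_gt0|exact: ltW|].
apply: (@le_trans _ _ (K / M * M)); last by rewrite divfK// gt_eqF.
have h1 : 0 <= 1 + (K - 1) * K ^+ D * ph.
  rewrite addr_ge0// mulr_ge0 ?(ltW ph0)// mulr_ge0 ?subr_ge0 ?(ltW K1)//.
  by rewrite exprn_ge0// (le_trans ler01)// ltW.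
have h2 : expR (th * b%:R) <= K / M.
  rewrite -[leRHS]lnK ?posrE; last by rewrite (lt_trans _ MK).
  rewrite ler_expR /th -mulrA -[leRHS]mulr1 ler_wpM2l ?(ltW t0)// mulrC.
  by rewrite ler_pdivrMr// mul1r ler_nat.
have h3 : 1 + (K - 1) * K ^+ D * ph <= M.
  by rewrite /M lerD2l -mulrA ler_wpM2l// subr_ge0 ltW.
exact: (ler_pM (expR_ge0 _) h1 h2 h3).
Qed.

End Constants.

(** * The cubic lattice *)

Section Lattice.
Variable d : nat.
Implicit Types (x y v a : vertex d) (e : edge d).

Definition lattice_link e x y : bool := val e == [fset x; y]%fset.

Lemma fset2_eq (T : choiceType) (x y x' y' : T) : [fset x; y]%fset = [fset x'; y']%fset ->
  (x' = x /\ y' = y) \/ (x' = y /\ y' = x).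
Proof.
move=> h.
have: x' \in [fset x; y]%fset by rewrite h !inE eqxx.
have: y' \in [fset x; y]%fset by rewrite h !inE eqxx orbT.
have: x \in [fset x'; y']%fset by rewrite -h !inE eqxx.
have: y \in [fset x'; y']%fset by rewrite -h !inE eqxx orbT.
rewrite !inE => /orP[]/eqP h1 /orP[]/eqP h2 /orP[]/eqP h3 /orP[]/eqP h4; subst; auto.
Qed.

Lemma lattice_link_ends e x y x' y' : lattice_link e x y -> lattice_link e x' y' ->
  (x' = x /\ y' = y) \/ (x' = y /\ y' = x).
Proof. by move=> /eqP h /eqP h'; apply: fset2_eq; rewrite -h. Qed.

Lemma adjacentC x y : Defs.adjacent x y -> Defs.adjacent y x.
Proof.
rewrite /Defs.adjacent /sqdist => /eqP <-; apply/eqP; apply: eq_bigr => i _.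
by rewrite -sqrrN opprB.
Qed.

Lemma lattice_link_adjacent e x y : lattice_link e x y -> Defs.adjacent x y.
Proof.
move=> /eqP h; have /asboolP[a [b [ab eab]]] := valP e.
rewrite h in eab; case: (fset2_eq eab) => -[-> ->] in ab *; first by [].
exact: adjacentC.
Qed.

Lemma adjacent_edge x y : Defs.adjacent x y -> exists e, lattice_link e x y.
Proof.
move=> xy; have h : is_edge [fset x; y]%fset by apply/asboolP; exists x, y.
by exists (exist (fun f => is_edge (d:=d) f) _ h); rewrite /lattice_link.
Qed.

Lemma adjacent_coord x y i : Defs.adjacent x y -> `|x ord0 i - y ord0 i| <= 1.
Proof.
rewrite /Defs.adjacent /sqdist (bigD1 i)//= => /eqP h.
have : 0 <= \sum_(j < d | j != i) (x ord0 j - y ord0 j) ^+ 2.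
  by apply: sumr_ge0 => j _; exact: sqr_ge0.
rewrite -(ler_sqr (x := `|_|)) ?nnegrE// real_normK ?num_real// expr1n; lra.
Qed.

Definition box_point (M : nat) (f : {ffun 'I_d -> 'I_(M + M).+1}) : vertex d :=
  \row_i ((f i)%:Z - M%:Z).

Definition box (M : nat) : {fset vertex d} := [fset box_point f | f in enum {ffun 'I_d -> 'I_(M + M).+1}]%fset.

Lemma boxP M v : v \in box M <-> forall i, `|v ord0 i| <= M%:Z.
Proof.
split=> [/imfsetP[f _ ->] i|h].
  rewrite mxE; have := ltn_ord (f i); move: (nat_of_ord (f i)) => k; lia.
have lt i : (absz (v ord0 i + M%:Z)%R < (M + M).+1)%N by have := h i; lia.
apply/imfsetP; exists [ffun i => Ordinal (lt i)]; first by rewrite /= mem_enum.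
apply/rowP => i; rewrite mxE ffunE /=; change (v 0 i) with (v ord0 i); have := h i; lia.
Qed.

Lemma box0 M : (0 : vertex d) \in box M.
Proof. by apply/boxP => i; rewrite mxE normr0. Qed.

Lemma box_mono M N : (M <= N)%N -> (box M `<=` box N)%fset.
Proof.
by move=> MN; apply/fsubsetP => v /boxP h; apply/boxP => i; apply: le_trans (h i) _; rewrite lez_nat.
Qed.

Lemma box_cover v : exists M, v \in box M.
Proof.
exists (\sum_(i < d) absz (v ord0 i))%N; apply/boxP => i.
by rewrite -abszE lez_nat (bigD1 i)//= leq_addr.
Qed.

Lemma fset_box_cover (S : {fset vertex d}) : exists M, (S `<=` box M)%fset.
Proof.
have ex v := cid (box_cover v).
exists (\max_(v <- S) sval (ex v))%N; apply/fsubsetP => v vS.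
apply: (fsubsetP (box_mono _) _ (svalP (ex v))).
exact: (@leq_bigmax_seq _ _ xpredT (fun v => sval (ex v))).
Qed.

Lemma lattice_link_finite x : finite_set [set e | exists y, lattice_link e x y].
Proof.
have [M xM] := box_cover x.
have -> : [set e | exists y, lattice_link e x y] =
    \bigcup_(y in [set` box M.+1]) [set e | val e = [fset x; y]%fset].
  apply/seteqP; split=> [e [y exy]|e [y _ /= h]]; last by exists y; apply/eqP.
  exists y; last exact/eqP.
  apply/boxP => i; have := adjacent_coord i (lattice_link_adjacent exy).
  have := (boxP _ _).1 xM i; lia.
apply: bigcup_finite => [|y _]; first exact: finite_fset.
apply: (@sub_finite_set _ _ [set e | exists2 e0, val e0 = [fset x; y]%fset & e = e0]).
  by move=> e /= h; exists e.
case: (pselect (exists e0 : edge d, val e0 = [fset x; y]%fset)) => [[e0 h0]|no].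
  apply: (@sub_finite_set _ _ [set e0]); last exact: finite_set1.
  by move=> e [e1 h1 ->] /=; apply: val_inj; rewrite h1 h0.
by apply: (@sub_finite_set _ _ set0) => // e [e1 h1 _]; apply: no; exists e1.
Qed.

Definition lattice : graph (vertex d) (edge d) :=
  Graph lattice_link_ends lattice_link_finite.

(** ** Translations *)

Lemma is_edge_shift a e : is_edge [fset (x + a)%R | x in val e]%fset.
Proof.
have /asboolP[x [y [xy ->]]] := valP e.
apply/asboolP; exists (x + a), (y + a); split.
  rewrite /Defs.adjacent /sqdist -(eqP xy); apply/eqP; apply: eq_bigr => i _.
  by rewrite !mxE; congr (_ ^+ 2); ring.
by rewrite imfsetU !imfset_fset1.
Qed.

Definition shift_edge a e : edge d :=
  exist (fun f => is_edge (d:=d) f) _ (is_edge_shift a e).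

Lemma shift_edgeK a : cancel (shift_edge a) (shift_edge (- a)).
Proof.
move=> e; apply: val_inj; apply/fsetP => x /=; apply/imfsetP/idP => /=.
  by move=> [y /imfsetP[/= z ze ->] ->]; rewrite addrK.
by move=> xe; exists (x + a); rewrite ?addrK//; apply/imfsetP; exists x.
Qed.

Lemma shift_edgeK' a : cancel (shift_edge (- a)) (shift_edge a).
Proof. by move=> e; rewrite -{1}(opprK a) shift_edgeK. Qed.

Lemma lattice_link_shift a e x y :
  lattice (shift_edge a e) (x + a) (y + a) = lattice e x y.
Proof.
rewrite /= /lattice_link /=.
have -> : [fset (x + a)%R; (y + a)%R]%fset = [fset (z + a)%R | z in [fset x; y]]%fset.
  by rewrite imfsetU !imfset_fset1.
apply/eqP/eqP => [h|-> //].
apply/fsetP => z; have := congr1 (fun A : {fset vertex d} => z + a \in A) h.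
have mem_shift (A : {fset vertex d}) :
    (z + a \in [fset (u + a)%R | u in A]%fset) = (z \in A).
  apply/imfsetP/idP => [[/= u uA /addIr -> //]|zA]; by exists z.
by rewrite !mem_shift.
Qed.

Definition shift_set a (S : {fset vertex d}) : {fset vertex d} := [fset (x + a)%R | x in S]%fset.

Lemma exit_rate_shift (R : realType) (q : R) S x a :
  exit_rate lattice q (shift_set a S) (x + a) = exit_rate lattice q S x.
Proof.
apply: (exit_rate_aut (f := fun x => x + a) (f' := fun x => x - a)
  (h := shift_edge a) (h' := shift_edge (- a))).
- by move=> z; rewrite addrK.
- by move=> z; rewrite subrK.
- exact: shift_edgeK.
- exact: shift_edgeK'.
- exact: lattice_link_shift.
Qed.

Lemma size_star_shift S a : size (star lattice (shift_set a S)) = size (star lattice S).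
Proof.
apply: (size_star_aut (f := fun x => x + a) (f' := fun x => x - a)
  (h := shift_edge a) (h' := shift_edge (- a))).
- by move=> z; rewrite subrK.
- exact: shift_edgeK.
- exact: shift_edgeK'.
- exact: lattice_link_shift.
Qed.

Lemma card_shift S a : #|` shift_set a S| = #|` S|.
Proof. by rewrite card_imfset//; exact: addIr. Qed.

(** ** Paths *)

Lemma is_path_walk x st : is_path x st = walk lattice x st.
Proof. by elim: st x => // -[e y] st IH x /=; rewrite IH. Qed.

Definition dist1 x y : nat := (\sum_(i < d) absz (x ord0 i - y ord0 i)%R)%N.

Lemma dist1_path x y : exists2 st, is_path x st & last x (unzip2 st) = y /\ size st = dist1 x y.
Proof.
have [n] := ubnP (dist1 x y); elim: n x => // n IH x; rewrite ltnS => xyn.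
have [<-|/eqP ne] := eqVneq x y.
  exists [::] => //; split=> //=; rewrite /dist1 big1// => i _; by rewrite subrr.
have [i xyi] : exists i, x ord0 i != y ord0 i.
  apply/existsP; apply: contra_notT ne => /existsPn h; apply/rowP => i.
  by have := h i; rewrite negbK => /eqP.
pose u : int := if x ord0 i < y ord0 i then 1 else -1.
pose z : vertex d := \row_j (x ord0 j + (if j == i then u else 0)).
have zi : z ord0 i = x ord0 i + u by rewrite mxE eqxx.
have zj j : j != i -> z ord0 j = x ord0 j by move=> ji; rewrite mxE (negbTE ji) addr0.
have dz : dist1 x y = (dist1 z y).+1.
  rewrite /dist1 (bigD1 i)//= [in RHS](bigD1 i)//= -addSn; congr addn.
    by rewrite zi /u; case: ltP => h; lia.
  by apply: eq_bigr => j ji; rewrite zj.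
have xz : Defs.adjacent x z.
  rewrite /Defs.adjacent /sqdist (bigD1 i)//= big1 ?addr0.
    by rewrite zi opprD addNKr sqrrN /u; case: ifP.
  by move=> j ji; rewrite zj// subrr expr0n.
have [e exz] := adjacent_edge xz.
have [|st zst [lst sst]] := IH z; first by rewrite -ltnS -dz.
by exists ((e, z) :: st); rewrite /= ?zst ?andbT ?lst ?sst.
Qed.

End Lattice.

(** * The product measure *)

Section FirstExit.
Variables (V E : choiceType) (g : graph V E).

Lemma first_exit (L : {fset V}) (O : set E) x v : x \in L -> conn g O x v ->
  (v \in L /\ conn g (O `&` touches g [set` L]) x v) \/
  exists2 u, u \notin L & conn g (O `&` touches g [set` L]) x u.
Proof.
move=> xL; elim=> [|y z e _ IH Oe yz]; first by left; split=> //; exact: conn0.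
case: IH => [[yL xy]|]; last by right.
have xz : conn g (O `&` touches g [set` L]) x z.
  by apply: (conn_step xy _ yz); split=> //; exists y, z.
by have [zL|zL] := boolP (z \in L); [left|right; exists z].
Qed.

(** A path leaving the larger set [L'] first leaves [L], through edges touching [L]. *)
Lemma leaves_sub (L L' : {fset V}) x w : (L `<=` L')%fset -> x \in L ->
  leaves g L' x w -> leaves g L x w.
Proof.
move=> /fsubsetP LL' xL [v vL' xv].
have oo : open_edges (touches g [set` L']) w `&` touches g [set` L] `<=`
    open_edges (touches g [set` L]) w by move=> e [[_ we] eL].
case: (first_exit xL xv) => [[vL _]|[u uL xu]].
  by rewrite (LL' _ vL) in vL'.
by exists u => //; exact: conn_mono xu.
Qed.

End FirstExit.

Section Cylinders.
Variables (R : realType) (d : nat).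
Implicit Types (s : seq (edge d)) (w : config d).

Lemma measurable_coordinate (e : edge d) (b : bool) :
  measurable [set w : config d | w e = b].
Proof. by apply: sub_sigma_algebra; exists e, b. Qed.

Lemma measurable_depends s (A : set (config d)) :
  (forall w w' : config d, {in s, w =1 w'} -> A w -> A w') -> measurable A.
Proof.
elim: s A => [|e s IH] A As.
  case: (pselect (exists w, A w)) => [[w Aw]|no].
    have -> : A = setT by apply/seteqP; split=> // w' _; exact: As Aw.
    exact: measurableT.
  have -> : A = set0 by apply/seteqP; split=> // w Aw; apply: no; exists w.
  exact: measurable0.
have mA b : measurable [set w : config d | A (upd w e b)].
  apply: IH => w w' ww'; apply: As => e'; rewrite inE /upd => /orP[->//|e's].
  by case: eqP => // _; exact: ww'.
have -> : A = ([set w : config d | A (upd w e true)] `&` [set w | w e = true]) `|`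
              ([set w : config d | A (upd w e false)] `&` [set w | w e = false]).
  have u (w : config d) b : w e = b -> upd w e b = w.
    by move=> <-; apply/funext => e'; rewrite /upd; case: eqP => // ->.
  apply/seteqP; split=> w /=.
    by case we: (w e) => Aw; [left|right]; rewrite u.
  by move=> [] [Aw we]; rewrite u in Aw.
by apply: measurableU; apply: measurableI => //; exact: measurable_coordinate.
Qed.

Lemma measurable_fun_depends s d' (T : measurableType d') (f : config d -> T) :
  (forall w w' : config d, {in s, w =1 w'} -> f w = f w') -> measurable_fun setT f.
Proof.
move=> fs _ B mB; apply: (measurable_depends (s := s)) => w w' ww' [_ fw].
by split=> //=; rewrite -(fs _ _ ww').
Qed.

Variables (p : R) (P : probability (config d) R).
Hypothesis hP : is_product_measure p P.

Let wt (b : bool) : R := if b then 1 - p else p.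

(** Fixing the edges of [t] lets the induction on [s] move one edge at a time from
    the averaged edges to the fixed ones, as in the definition of [Ex]. *)
Lemma integral_cylinder s (t : {fset edge d}) (f : (edge d -> bool) -> R) (w : config d) :
  uniq s -> {in s, forall e, e \notin t} -> (forall w, 0 <= f w) ->
  depends_on ([set` s] `|` [set` t]) f ->
  (\int[P]_(w' in [set w' : config d | forall e, e \in t -> w' e = w e]) (f w')%:E =
   ((\prod_(e <- t) wt (w e)) * Ex p s f w)%:E)%E.
Proof.
move=> us st f0 fs.
pose C (t : {fset edge d}) (w : config d) : set (config d) :=
  [set w' : config d | forall e, e \in t -> w' e = w e].
have mC t' w' : measurable (C t' w').
  apply: (measurable_depends (s := t')) => w1 w2 w12 h e et.
  by rewrite -w12// h.
have mf : measurable_fun setT (EFin \o (f : config d -> R)).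
  apply/measurable_EFinP; apply: (measurable_fun_depends (s := s ++ t)) => w1 w2 w12.
  by apply: fs => e [/= h|/= h]; apply: w12; rewrite mem_cat h ?orbT.
have f0' (w' : config d) : (0 <= (f w')%:E)%E by rewrite lee_fin.
rewrite -/(C t w); elim: s t w us st fs => [|e s IH] t w /=.
  move=> _ _ fs; rewrite (eq_integral (fun=> (f w)%:E)); last first.
    move=> w' /set_mem h; congr (_%:E); apply: fs => e [//|/= et]; exact: h.
  by rewrite integral_cst//= [X in (_ * X)%E](hP t w) -EFinM mulrC.
move=> /andP[es us] st fs.
have et : e \notin t by apply: st; rewrite mem_head.
have splitC : C t w = C (e |` t)%fset (upd w e false) `|` C (e |` t)%fset (upd w e true).
  apply/seteqP; split=> w'.
    move=> h; case we: (w' e); [right|left] => e'; rewrite !inE => /orP[/eqP ->|e't];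
      rewrite ?upd_same// upd_other ?h//; by apply: contraNneq et => <-.
  by move=> [] h e' e't; rewrite (h e') ?inE ?e't ?orbT// upd_other//;
    apply: contraNneq et => <-.
have dis : [disjoint C (e |` t)%fset (upd w e false) & C (e |` t)%fset (upd w e true)].
  apply/disj_setPS => w' [h1 h2].
  by have := h1 e (fset1U1 _ _); rewrite (h2 e (fset1U1 _ _)) !upd_same.
have fs' : depends_on ([set` s] `|` [set` (e |` t)%fset]) f.
  apply: depends_on_sub fs => e' [/=|/= e't].
    by rewrite in_cons => /orP[/eqP ->|]; [right; exact: fset1U1|left].
  by right; apply/fset1UP; right.
have st' : {in s, forall e', e' \notin (e |` t)%fset}.
  move=> e' e's; rewrite !inE negb_or st ?inE ?e's ?orbT// andbT.
  by apply: contraNneq es => <-.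
have pr b : \prod_(e' <- (e |` t)%fset) wt (upd w e b e') = wt b * \prod_(e' <- t) wt (w e').
  rewrite big_fsetU1//= upd_same; congr (_ * _).
  rewrite big_seq [in RHS]big_seq; apply: eq_bigr => e' e't; rewrite upd_other//.
  by apply: contraNneq et => <-.
rewrite splitC ge0_integral_setU//; last exact: measurable_funTS.
rewrite !IH// !pr -EFinD; congr (_%:E); rewrite /wt; ring.
Qed.

Lemma integral_Ex s (f : (edge d -> bool) -> R) w :
  uniq s -> (forall w, 0 <= f w) -> depends_on [set` s] f ->
  (\int[P]_(w' in setT) (f w')%:E = (Ex p s f w)%:E)%E.
Proof.
move=> us f0 fs.
have := @integral_cylinder s fset0 f w us (fun=> fun=> isT) f0.
rewrite big_seq_fset0 mul1r => <-; last by apply: depends_on_sub fs => e; left.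
by congr integral; apply/seteqP; split=> // w' _ e; rewrite inE.
Qed.

Lemma prob_Ex s (A : set (config d)) w : uniq s ->
  depends_on [set` s] (fun w => ind R (A w)) ->
  P A = (Ex p s (fun w => ind R (A w)) w)%:E.
Proof.
move=> us As; rewrite -integral_Ex//.
have mA : measurable A.
  apply: (measurable_depends (s := s)) => w1 w2 w12 A1.
  have := As w1 w2 (fun e es => w12 e es); rewrite (ind_true _ A1).
  by case: (pselect (A w2)) => // /(ind_false R) -> /eqP; rewrite oner_eq0.
by rewrite -[X in P X](setIT) -integral_indic.
Qed.

End Cylinders.

Section Critical.
Variables (R : realType) (d : nat).

Lemma open_cluster_conn (w : config d) :
  open_cluster w = [set v | conn (lattice d) [set e | ~~ w e] 0 v].
Proof.
apply/seteqP; split=> v.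
- move=> [[x st pst] [/= x0 <- ow]]; subst x; apply: (walk_conn (st := st)).
  + by rewrite -is_path_walk.
  + by move=> e /= /mapP[a ast ->]; rewrite /= ow.
  + by rewrite mem_last.
- move=> /=; elim=> [|y z e _ [[x st pst] [/= x0 stz ow]] we yz].
    by exists (@LPath d 0 [::] isT); split.
  have pst' : is_path x (rcons st (e, z)).
    rewrite /lpath_end /= in stz.
    elim: st x pst stz {x0 ow} => [|[e' y'] st IH] x /=; first by move=> _ ->; rewrite andbT.
    by move=> /andP[-> h1 h2]; exact: IH.
  exists (LPath pst'); split=> //=.
    by rewrite /lpath_end /= /unzip2 map_rcons last_rcons.
  move=> a; rewrite mem_rcons inE => /orP[/eqP -> /=|]; last exact: ow.
  exact: negbTE.
Qed.

Lemma infinite_cluster :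
  [set w : config d | infinite_set (open_cluster w)] =
  \bigcap_n [set w : config d | leaves (lattice d) (box d n) 0 w].
Proof.
apply/seteqP; split=> w /=; rewrite open_cluster_conn.
- move=> inf n _ /=; apply: contrapT => nol; apply: inf.
  apply: (@sub_finite_set _ _ [set` box d n]) => [v /= ov|]; last exact: finite_fset.
  have [[//]|[u ubox ou]] := first_exit (box0 d n) ov; case: nol; exists u => //.
  by apply: conn_mono ou => e [h1 h2].
- move=> out fin.
  have [M CM] := fset_box_cover (fset_set [set v | conn (lattice d) [set e | ~~ w e] 0 v]).
  have [v vM ov] := out M I; move/negP: vM; apply; apply: (fsubsetP CM).
  rewrite in_fset_set//; apply/mem_set => /=.
  by apply: conn_mono ov => e [].
Qed.

(** Were all exit rates at [p] at least 1, the origin would be connected to the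
    outside of every box with probability at least [1 - expR (p - q)] at the
    parameter [q], hence to infinity with the same probability. *)
Lemma subcritical_exit_rate (p q : R) (Q : probability (config d) R) :
  is_product_measure q Q -> 0 <= p -> p < q -> q <= 1 ->
  Q [set w : config d | infinite_set (open_cluster w)] = 0%E ->
  exists2 S : {fset vertex d}, 0 \in S & exit_rate (lattice d) p S 0 < 1.
Proof.
move=> hQ p0 pq q1 Q0; apply: contrapT => no.
have rate (S : {fset vertex d}) : 0 \in S -> 1 <= exit_rate (lattice d) p S 0.
  by move=> oS; rewrite leNgt; apply/negP => lt1; apply: no; exists S.
pose F n := [set w : config d | leaves (lattice d) (box d n) 0 w].
have dF n : depends_on [set` star (lattice d) (box d n)]
    (fun w => ind R (leaves (lattice d) (box d n) 0 w)).
  by apply: depends_on_sub (@depends_on_leaves R _ _ _ _ _) => e h; apply/starP.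
have lowF n : ((1 - expR (p - q))%:E <= Q (F n))%E.
  rewrite (prob_Ex hQ xpredT (star_uniq _ _) (dF n)) lee_fin.
  apply: leaves_lower_bound => //; first exact: box0.
  by move=> S _; exact: rate.
have mF n : measurable (F n).
  apply: (measurable_depends (s := star (lattice d) (box d n))) => w w' ww' [v vb ov].
  exists v => //; rewrite -(eq_open_edges (w := w))// => e h; apply: ww'; exact/starP.
have cF : Q (F n) @[n --> \oo] --> Q (\bigcap_n F n).
  apply: nonincreasing_cvg_mu => //.
  - by rewrite ltey_eq fin_num_measure.
  - exact: bigcap_measurable.
  - move=> n m nm; apply/subsetPset => w; apply: leaves_sub; last exact: box0.
    exact: box_mono.
have : ((1 - expR (p - q))%:E <= Q (\bigcap_n F n))%E.
  rewrite -(cvg_lim _ cF)//; apply: lime_ge; first by apply/cvg_ex; eexists; exact: cF.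
  by apply: nearW => n; exact: lowF.
rewrite -infinite_cluster Q0 lee_fin subr_le0 leNgt expR_lt1 subr_lt0 pq.
by [].
Qed.

(** The sprinkled measure of parameter [p + (1 - p) * lam] is still subcritical,
    and there a translate of one and the same finite set serves as the block of
    each vertex. *)
Lemma subcritical_moment (p : R) : 0 < p -> p < critical_probability R d ->
  exists lam th K : R, [/\ [/\ p <= 1, 0 < lam, lam <= 1 & 0 < th] &
    forall s (vs : seq (vertex d)), uniq s -> uniq vs ->
      Ex (p + (1 - p) * lam) s (fun w => expR (th * cnt R vs
        (cluster (lattice d) s [:: 0] w))) xpredT <= K].
Proof.
move=> p0 pc.
pose Z := [set q : R | 0 <= q <= 1 /\ exists P : probability (config d) R,
  is_product_measure q P /\
  P [set w : config d | infinite_set (open_cluster w)] = 0%E].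
have Zne : Z !=set0.
  apply: contrapT => Z0; move: pc; rewrite /critical_probability -/Z.
  suff -> : Z = set0 by rewrite sup0 ltNge (ltW p0).
  by apply/seteqP; split=> // q Zq; apply: Z0; exists q.
have [q [/andP[q0 q1] [Q [hQ Q0]]] pq] := sup_gt Zne pc.
pose p' := (p + q) / 2.
have pp' : p < p' by rewrite /p'; lra.
have p'q : p' < q by rewrite /p'; lra.
have p'1 : p' <= 1 by lra.
have p'0 : 0 <= p' by lra.
have [S oS rate] := subcritical_exit_rate hQ p'0 p'q q1 Q0.
have p1 : 0 < 1 - p by lra.
pose lam := (p' - p) / (1 - p).
have ple1 : p <= 1 by lra.
have lam0 : 0 < lam by rewrite /lam divr_gt0// subr_gt0.
have lam1 : lam <= 1 by rewrite /lam ler_pdivrMr//; lra.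
have pE : p + (1 - p) * lam = p' by rewrite /lam mulrC divfK ?gt_eqF//; ring.
pose r := exit_rate (lattice d) p' S 0.
have r0 : 0 <= r.
  by apply: sumr_ge0 => e _; apply: Ex_ge0 => // w; exact: ind_ge0.
pose ph := (1 + r) / 2.
have ph0 : 0 < ph by rewrite /ph; lra.
have rph : r <= ph by rewrite /ph /r; lra.
have ph1 : ph < 1 by rewrite /ph /r; lra.
have [th [K [th0 K1 thK]]] :=
  @exp_moment_constants R ph #|` S| (size (star (lattice d) S)) ph0 ph1.
exists lam, th, (K ^+ 1); split; first by split.
move=> s vs us uvs; rewrite pE.
apply: (@cluster_exp_moment R _ _ (lattice d) p' th K ph #|` S|
  (size (star (lattice d) S)) (fun x => shift_set x S) _ _ _ _ _ _ _ _ vs s [:: 0]) => //.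
- by rewrite p'0.
- exact: ltW.
- by move=> x; apply/imfsetP; exists 0; rewrite ?add0r.
- by move=> x; rewrite card_shift.
- by move=> x; rewrite size_star_shift.
- move=> x; rewrite -{2}(add0r x) exit_rate_shift -/r.
  apply: (@le_trans _ _ r); first by rewrite ler_piMl.
  exact: rph.
Qed.

End Critical.

(** * Passage times and the time constant *)

Section PassageTimes.
Variable d : nat.
Implicit Types (u v x y : vertex d) (w : config d).

Lemma walk_cat x st st' : walk (lattice d) x (st ++ st') =
  walk (lattice d) x st && walk (lattice d) (last x (unzip2 st)) st'.
Proof. by elim: st x => // -[e y] st IH x /=; rewrite IH andbA. Qed.

Lemma time_cat w (st st' : seq (edge d * vertex d)) :
  time w (st ++ st') = (time w st + time w st')%N.
Proof. by rewrite /time big_cat. Qed.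

Lemma walk_in_box x st : walk (lattice d) x st ->
  exists M, {subset unzip1 st <= star (lattice d) (box d M)}.
Proof.
elim: st x => [|[e y] st IH] x /=; first by exists 0%N.
move=> /andP[exy /IH[M sM]]; have [N xN] := box_cover x.
exists (maxn M N) => e'; rewrite inE => /orP[/eqP ->|/sM].
  apply/starP; exists x, y; split=> //=.
  by apply: (fsubsetP (box_mono _ _)) xN; rewrite leq_maxr.
by apply: star_mono; apply: box_mono; rewrite leq_maxl.
Qed.

Lemma fastest_path w (A B : set (vertex d)) : paths_between A B !=set0 ->
  exists2 g, paths_between A B g &
    forall g', paths_between A B g' -> (path_time w g <= path_time w g')%N.
Proof.
move=> [g0 g0AB].
have ex : exists n, `[< exists2 g, paths_between A B g & path_time w g = n >].
  by exists (path_time w g0); apply/asboolP; exists g0.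
case: (ex_minnP ex) => m /asboolP[g gAB tm] min.
by exists g => // g' g'AB; rewrite tm; apply: min; apply/asboolP; exists g'.
Qed.

Lemma passage_time_fastest (R : realType) w (A B : set (vertex d)) g :
  paths_between A B g ->
  (forall g', paths_between A B g' -> (path_time w g <= path_time w g')%N) ->
  passage_time R w A B = ((path_time w g)%:R)%:E.
Proof.
move=> gAB gmin; apply/eqP; rewrite eq_le; apply/andP; split.
  by apply: ereal_inf_lbound; exists g.
by apply: le_ereal_inf_tmp => _ [g' g'AB <-]; rewrite lee_fin ler_nat gmin.
Qed.

Definition is_tau w u v n := (exists g, [/\ paths_between [set u] [set v] g,
  path_time w g = n & forall g', paths_between [set u] [set v] g' -> (n <= path_time w g')%N]).

Definition tau w u v : nat := xget 0%N [set n | is_tau w u v n].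

Lemma paths_between_ne u v : paths_between [set u] [set v] !=set0.
Proof.
have [st ust [stv _]] := dist1_path u v.
by exists (LPath ust); split.
Qed.

Lemma tauP w u v : is_tau w u v (tau w u v).
Proof.
rewrite /tau; case: xgetP => [n _ //|/= no].
have [g gb gmin] := fastest_path w (paths_between_ne u v).
by case: (no (path_time w g)); exists g.
Qed.

Lemma passage_time_tau (R : realType) w u v :
  passage_time R w [set u] [set v] = ((tau w u v)%:R)%:E.
Proof.
by have [g [gb <- gmin]] := tauP w u v; exact: passage_time_fastest.
Qed.

Lemma tau_le_time w u v st : walk (lattice d) u st -> last u (unzip2 st) = v ->
  (tau w u v <= time w st)%N.
Proof.
rewrite -is_path_walk => ust stv; have [g [_ _]] := tauP w u v.
by move=> /(_ (LPath ust)); apply.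
Qed.

Lemma tau_walk w u v : exists st, [/\ walk (lattice d) u st, last u (unzip2 st) = v &
  time w st = tau w u v].
Proof.
have [[x st xst] [[/= xu <-] <- _]] := tauP w u v; subst x.
by exists st; rewrite -is_path_walk.
Qed.

Lemma tau_triangle w u v x : (tau w u x <= tau w u v + dist1 v x)%N.
Proof.
have [st [ust stv <-]] := tau_walk w u v.
have [st' vst' [stx <-]] := dist1_path v x.
apply: (@leq_trans (time w (st ++ st'))).
  apply: tau_le_time; first by rewrite walk_cat ust stv -is_path_walk.
  by rewrite /unzip2 map_cat last_cat stv.
by rewrite time_cat leq_add2l time_size.
Qed.

Lemma dist1C u v : dist1 u v = dist1 v u.
Proof. by apply: eq_bigr => i _; rewrite -abszN opprB. Qed.

Lemma tau_lip (R : realType) w u v x :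
  `|(tau w u v)%:R - (tau w u x)%:R| <= (dist1 v x)%:R :> R.
Proof.
rewrite ler_distl lerBlDr -!natrD !ler_nat tau_triangle /=.
by rewrite [dist1 v x]dist1C tau_triangle.
Qed.

Lemma tau_refl w u : tau w u u = 0%N.
Proof.
apply/eqP; rewrite -leqn0.
have := @tau_le_time w u u [::] isT erefl; by rewrite /time big_nil.
Qed.

(** There are countably many boxes, and in each box the event that a path of time at
    most [k] exists depends on finitely many edges. *)
Lemma measurable_tau_le u v k : measurable [set w : config d | (tau w u v <= k)%N].
Proof.
have -> : [set w : config d | (tau w u v <= k)%N] = \bigcup_M [set w : config d |
    exists st, [/\ walk (lattice d) u st, last u (unzip2 st) = v,
      {subset unzip1 st <= star (lattice d) (box d M)} & (time w st <= k)%N]].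
  apply/seteqP; split=> w /=.
    have [st [ust stv <-]] := tau_walk w u v => tk.
    by have [M sM] := walk_in_box ust; exists M => //; exists st.
  move=> [M _ [st [ust stv _ tk]]]; exact: leq_trans (tau_le_time w ust stv) tk.
apply: bigcup_measurable => M _.
apply: (measurable_depends (s := star (lattice d) (box d M))) => w w' ww' [st [h1 h2 h3 h4]].
by exists st; split=> //; rewrite -(time_eq (w := w))// => e /h3 /ww'.
Qed.

Lemma measurable_tau (R : realType) u v :
  measurable_fun setT (fun w : config d => (tau w u v)%:R : R).
Proof.
have m1 k : measurable [set w : config d | tau w u v = k].
  have -> : [set w : config d | tau w u v = k] = [set w : config d | (tau w u v <= k)%N] `\`
      \bigcup_(j in [set j | (j < k)%N]) [set w : config d | (tau w u v <= j)%N].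
    apply/seteqP; split=> w /=.
      move=> <-; split; first by [].
      by move=> [j /= h1 h2]; move: (leq_ltn_trans h2 h1); rewrite ltnn.
    move=> [h1 h2]; apply/eqP; rewrite eqn_leq h1 /= leqNgt; apply/negP => h.
    by apply: h2; exists (tau w u v); [exact: h|exact: leqnn].
  by apply: measurableD; [|apply: bigcup_measurable => j _]; exact: measurable_tau_le.
move=> _ B _; rewrite setTI.
have -> : (fun w : config d => (tau w u v)%:R : R) @^-1` B =
    \bigcup_(k in [set k | B k%:R]) [set w : config d | tau w u v = k].
  by apply/seteqP; split=> w /=; [move=> h; exists (tau w u v)|move=> [k /= Bk ->]].
by apply: bigcup_measurable => k _; exact: m1.
Qed.

End PassageTimes.

Section Nearest.
Variables (R : realType) (d : nat).
Implicit Types (x y : 'rV[R]_d) (v : vertex d).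

Lemma nearest_int (r : R) : exists k : int, (forall j : int, `|r - k%:~R| <= `|r - j%:~R|) /\
  `|r - k%:~R| <= 1.
Proof.
pose k := Num.floor (r + 2^-1); exists k.
have /andP[h1 h2] := floor_itv (r + 2^-1).
rewrite -/k intrD in h1 h2.
have h : `|r - k%:~R| <= 2^-1 by rewrite ler_norml; apply/andP; split; lra.
split; last by apply: le_trans h _; lra.
move=> j; have [->//|jk] := eqVneq j k; apply: le_trans h _.
have : (j <= k - 1) || (k + 1 <= j) by lia.
move=> /orP[jk'|jk'].
  have : j%:~R <= k%:~R - 1 :> R by rewrite -[1]/(1%:~R) -intrB ler_int.
  by move=> ?; apply: le_trans (ler_norm _); lra.
have : k%:~R + 1 <= j%:~R :> R by rewrite -[1]/(1%:~R) -intrD ler_int.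
by move=> ?; rewrite distrC; apply: le_trans (ler_norm _); lra.
Qed.

Lemma nearest_vertexP x :
  forall u : vertex d, sqdist x (embed R (nearest_vertex x)) <= sqdist x (embed R u).
Proof.
rewrite /nearest_vertex; case: xgetP => [v _ [//]|/= no]; exfalso.
have ex i := cid (nearest_int (x ord0 i)).
pose v0 : vertex d := \row_i sval (ex i).
have min0 u : sqdist x (embed R v0) <= sqdist x (embed R u).
  apply: ler_sum => i _; rewrite /embed !mxE.
  rewrite -[leLHS]real_normK ?num_real// -[leRHS]real_normK ?num_real//.
  by rewrite lerXn2r ?nnegrE//; exact: (svalP (ex i)).1.
have exn : exists n, `[< exists2 v : vertex d, choice.pickle v = n &
    forall u : vertex d, sqdist x (embed R v) <= sqdist x (embed R u) >].
  by exists (choice.pickle v0); apply/asboolP; exists v0.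
case: (ex_minnP exn) => n /asboolP[v vn vmin] nmin.
apply: (no v); split=> // u uv; rewrite vn; apply: nmin.
by apply/asboolP; exists u => // u'; rewrite uv.
Qed.

(** Compare with rounding each coordinate, which gives a vertex at squared distance
    at most [d]. *)
Lemma nearest_vertex_close x i :
  `|x ord0 i - (nearest_vertex x ord0 i)%:~R| <= d%:R.
Proof.
have ex i := cid (nearest_int (x ord0 i)).
pose v0 : vertex d := \row_i sval (ex i).
have le0 : sqdist x (embed R v0) <= d%:R.
  rewrite -[X in X%:R](card_ord d) -sum1_card natr_sum; apply: ler_sum => j _.
  rewrite /embed !mxE -[leLHS]real_normK ?num_real// expr_le1//.
  exact: (svalP (ex j)).2.
have h : `|x ord0 i - (nearest_vertex x ord0 i)%:~R| ^+ 2 <= d%:R.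
  apply: le_trans (le_trans (nearest_vertexP x v0) le0).
  rewrite real_normK ?num_real// /sqdist (bigD1 i)//= /embed mxE lerDl.
  by apply: sumr_ge0 => j _; exact: sqr_ge0.
have d1 : 1 <= d%:R :> R by rewrite ler1n; case: i {h}; case: (d).
rewrite -(ler_sqr (x := `|_|)) ?nnegrE//; apply: le_trans h _.
by rewrite expr2 ler_peMr.
Qed.

Definition near_cst (c : R) : R := d%:R * (d%:R + d%:R + c).

Lemma dist1_nearest x y (c : R) : (forall i, `|x ord0 i - y ord0 i| <= c) ->
  (dist1 (nearest_vertex x) (nearest_vertex y))%:R <= near_cst c.
Proof.
move=> xy; rewrite /dist1 natr_sum /near_cst.
rewrite [X in X * _](_ : _ = \sum_(i < d) 1); last by rewrite sumr_const card_ord.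
rewrite mulr_suml; apply: ler_sum => i _; rewrite mul1r.
rewrite -[(absz _)%:R]/((Posz (absz _))%:~R : R) abszE intr_norm intrB.
have h1 := nearest_vertex_close x i; have h2 := nearest_vertex_close y i.
have h3 := xy i; move: h1 h2 h3; rewrite !ler_norml.
by move=> /andP[? ?] /andP[? ?] /andP[? ?]; apply/andP; split; lra.
Qed.

End Nearest.

Lemma cvg_affine_subseq (R : realType) (C a : R) (err : nat -> \bar R) (j : nat -> nat) :
  err @ \oo --> 0%E -> j k @[k --> \oo] --> \oo ->
  (fun k => (C / k%:R)%:E + a%:E * err (j k))%E @ \oo --> 0%E.
Proof.
move=> e0 jy.
have c2 : (fun k => a%:E * err (j k))%E @ \oo --> (a%:E * 0)%E.
  apply: cvgeZl; first by [].
  exact: (cvg_comp _ _ jy e0).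
have c3 : (fun k => (C / k%:R)%:E) @ \oo --> (C * 0)%:E.
  apply/cvg_EFin; first exact: nearW.
  rewrite /comp /=; apply: cvgMr.
  apply/gtr0_cvgV0; last exact: cvgr_idn.
  by exists 1%N => // k /= k1; rewrite ltr0n.
rewrite mulr0 in c3; rewrite mule0 in c2.
have c4 : (fun k => (C / k%:R)%:E + a%:E * err (j k))%E @ \oo --> (0%:E + 0)%E.
  exact: cvgeD.
by rewrite adde0 in c4.
Qed.

Section TimeConstant.
Variables (R : realType) (d : nat) (P : probability (config d) R).
Implicit Types (x y : 'rV[R]_d) (m a c : R) (w : config d) (n k : nat).

Lemma integral_le_affine (f h : config d -> R) a c : 0 <= a -> 0 <= c ->
  (forall w, 0 <= f w) -> (forall w, 0 <= h w) ->
  measurable_fun setT f -> measurable_fun setT h ->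
  (forall w, f w <= c + a * h w) ->
  (\int[P]_w (f w)%:E <= c%:E + a%:E * \int[P]_w (h w)%:E)%E.
Proof.
move=> a0 c0 f0 h0 mf mh fh.
have mh' : measurable_fun setT (fun w => (h w)%:E) by apply/measurable_EFinP.
have mah : measurable_fun setT (fun w => (a%:E * (h w)%:E)%E).
  by apply/measurable_EFinP; exact: measurable_funM.
have ah0 w : setT w -> (0 <= a%:E * (h w)%:E)%E by rewrite -EFinM lee_fin mulr_ge0.
have -> : c%:E = (\int[P]_w (cst c%:E w))%E.
  by rewrite integral_cst// [X in (_ * X)%E]probability_setT mule1.
rewrite -ge0_integralZl_EFin//; last by move=> w _; rewrite lee_fin.
rewrite -ge0_integralD//=.
apply: ge0_le_integral => //.
- by move=> w _; rewrite lee_fin.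
- exact/measurable_EFinP.
- by apply: emeasurable_funD => //; exact: measurable_cst.
- by move=> w _; rewrite -EFinM -EFinD lee_fin.
Qed.

(** The quantity whose mean tends to 0 in the definition of the time constant. *)
Definition deviation x m k w : R := 
  `|k%:R^-1 * (tau w (nearest_vertex (0 : 'rV[R]_d)) (nearest_vertex (k%:R *: x)))%:R - m|.

Definition converges_to x m : Prop :=
  (fun k => (\int[P]_w (deviation x m k w)%:E)%E) @ \oo --> 0%E.

Lemma time_constantE x : time_constant P x = get [set m | converges_to x m].
Proof.
have E m : (fun n : nat => (\int[P]_w
      `|(n%:R^-1)%:E * passage_time_pt w 0 (n%:R *: x) - m%:E|)%E) =
    (fun k => (\int[P]_w (deviation x m k w)%:E)%E).
  apply/funext => n; apply: eq_integral => w _.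
  by rewrite /passage_time_pt passage_time_tau /deviation -EFinM -EFinB abse_EFin.
by rewrite /time_constant; congr (get _); apply/funext => m; rewrite /mkset E.
Qed.

Lemma deviation_ge0 x m k w : 0 <= deviation x m k w.
Proof. exact: normr_ge0. Qed.

Lemma measurable_deviation x m k : measurable_fun setT (deviation x m k).
Proof.
apply: (measurableT_comp (@normr_measurable R setT)).
apply: measurable_funB; last exact: measurable_cst.
by apply: measurable_funM; [exact: measurable_cst|exact: measurable_tau].
Qed.

Lemma limit_unique x m m' : converges_to x m -> converges_to x m' -> m = m'.
Proof.
move=> cm cm'; apply/eqP; rewrite -subr_eq0 -normr_le0.
suff : (`|m - m'|%:E <= 0)%E by rewrite lee_fin.
have c0 : (fun k => (\int[P]_w (deviation x m k w)%:E +
    \int[P]_w (deviation x m' k w)%:E)%E) @ \oo --> 0%E.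
  by rewrite -[X in _ --> X]adde0; exact: cvgeD.
rewrite -(cvg_lim _ c0)//; apply: lime_ge; first by apply/cvg_ex; eexists; exact: c0.
apply: nearW => k.
have -> : (`|m - m'|)%:E = (\int[P]_w (cst (`|m - m'|)%:E w))%E.
  by rewrite integral_cst// [X in (_ * X)%E]probability_setT mule1.
have mE m0 : measurable_fun setT (fun w => (deviation x m0 k w)%:E).
  by apply/measurable_EFinP; exact: measurable_deviation.
have E0 m0 w : setT w -> (0 <= (deviation x m0 k w)%:E)%E.
  by rewrite lee_fin deviation_ge0.
rewrite -ge0_integralD//; [|exact: E0|exact: E0].
apply: ge0_le_integral => //; first by move=> w _; rewrite lee_fin.
  exact: emeasurable_funD.
move=> w _; rewrite -EFinD lee_fin /cst /deviation.
set z := _ * _; rewrite -[m - m'](_ : (m - z) + (z - m') = _); last by ring.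
by rewrite (le_trans (ler_normD _ _))// distrC.
Qed.

Lemma converges_time_constant x m : converges_to x m -> time_constant P x = m.
Proof.
move=> cm; apply: (limit_unique _ cm); rewrite time_constantE.
by apply: (getPex (P := [set m | converges_to x m])); exists m.
Qed.

(** Where no limit exists [time_constant] takes the default value 0, so a value above
    1 is a true limit. *)
Lemma time_constant_gt1 x : 1 < time_constant P x -> converges_to x (time_constant P x).
Proof.
rewrite time_constantE => gt1; apply: (getPex (P := [set m | converges_to x m])).
apply: contrapT => no; move: gt1; rewrite getPN => [|m cm]; last by apply: no; exists m.
by apply/negP; rewrite -leNgt; exact: ler01.
Qed.

Lemma time_constant0 : time_constant P 0 <= 1.
Proof.
rewrite (@converges_time_constant 0 0) ?ler01//.
apply: cvg_near_cst; apply: nearW => k.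
rewrite (eq_integral (cst 0%E)) ?integral0// => w _.
by rewrite /deviation scaler0 tau_refl mulr0 subr0 normr0.
Qed.

(** The points [k a x] and [j x], where [j] is the integer part of [k a], stay at
    a bounded distance, so their passage times differ by a bounded amount. *)
Lemma deviation_scale x m a : 0 < a -> exists2 C, 0 <= C &
  forall k w, (0 < Num.truncn (k%:R * a))%N ->
  deviation (a *: x) (a * m) k w <=
    C / k%:R + a * deviation x m (Num.truncn (k%:R * a)) w.
Proof.
move=> a0; pose c := \sum_(i < d) `|x ord0 i|.
exists (near_cst d c + `|m|).
  rewrite addr_ge0// /near_cst mulr_ge0// addr_ge0//.
  by apply: sumr_ge0.
move=> k w; set j := Num.truncn _ => j0.
have ka0 : 0 <= k%:R * a by rewrite mulr_ge0// ltW.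
have /andP[jle jgt] := truncn_itv ka0; rewrite -/j in jle jgt.
have k0 : 0 < k%:R :> R.
  rewrite ltr0n lt0n; apply/negP => /eqP k0; move: j0; rewrite /j k0 mul0r.
  by rewrite truncn0.
have jR0 : 0 < j%:R :> R by rewrite ltr0n.
pose T := tau w (nearest_vertex (0 : 'rV[R]_d)).
pose u := nearest_vertex (k%:R *: (a *: x)); pose v := nearest_vertex (j%:R *: x).
have close : `|(T u)%:R - (T v)%:R| <= near_cst d c.
  apply: le_trans (tau_lip R _ _ _ _) _; apply: dist1_nearest => i.
  rewrite scalerA !mxE -mulrBl normrM.
  apply: (@le_trans _ _ (1 * `|x ord0 i|)).
    rewrite ler_wpM2r// ler_norml; apply/andP; split; first by lra.
    by rewrite lerBlDl -natr1 in jgt *; lra.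
  by rewrite mul1r /c (bigD1 i)//= lerDl sumr_ge0.
have jk : `|j%:R - k%:R * a| <= 1.
  by rewrite ler_norml -natr1 in jgt *; apply/andP; split; lra.
rewrite /deviation -/T -/u -/v.
have -> : k%:R^-1 * (T u)%:R - a * m =
    k%:R^-1 * (((T u)%:R - (T v)%:R) + j%:R * (j%:R^-1 * (T v)%:R - m)
               + (j%:R - k%:R * a) * m).
  by field; rewrite !gt_eqF.
rewrite normrM normfV (ger0_norm (ltW k0)) [leLHS]mulrC ler_pdivrMr//.
rewrite [leRHS]mulrDl divfK ?gt_eqF//.
apply: le_trans (ler_normD _ _) _; apply: le_trans (lerD (ler_normD _ _) (lexx _)) _.
rewrite !normrM (ger0_norm (ltW jR0)) -/(deviation x m j w).
have D0 := deviation_ge0 x m j w; set D := deviation x m j w in D0 *.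
have h1 : j%:R * D <= a * D * k%:R by rewrite mulrAC ler_wpM2r// mulrC.
have h2 : `|j%:R - k%:R * a| * `|m| <= `|m| by rewrite -[leRHS]mul1r ler_wpM2r.
rewrite addrAC; apply: lerD; [exact: lerD|exact: h1].
Qed.

Lemma converges_scale x m a : 0 < a -> converges_to x m -> converges_to (a *: x) (a * m).
Proof.
move=> a0 cm; have [C C0 le] := deviation_scale x m a0.
pose j k := Num.truncn (k%:R * a).
have jy : j k @[k --> \oo] --> \oo.
  apply/cvgnyPge => N; near=> k.
  rewrite /j truncn_ge_nat ?mulr_ge0// ?(ltW a0)// -ler_pdivrMr//.
  by near: k; exact: nbhs_infty_ger.
have c1 := cvg_affine_subseq C a cm jy.
have jpos : \forall k \near \oo, (0 < j k)%N by move/cvgnyPge: jy => /(_ 1%N).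
apply: (squeeze_cvge _ (cvg_cst 0%E) c1); near=> k; apply/andP; split.
  by apply: integral_ge0 => w _; rewrite lee_fin deviation_ge0.
apply: integral_le_affine; rewrite ?(ltW a0) ?divr_ge0//.
- by move=> w; exact: deviation_ge0.
- by move=> w; exact: deviation_ge0.
- exact: measurable_deviation.
- exact: measurable_deviation.
- move=> w; apply: le; near: k; exact: jpos.
Unshelve. all: by end_near. Qed.

Lemma time_constant_ray x a : 1 <= a -> 1 < time_constant P x ->
  1 < time_constant P (a *: x).
Proof.
move=> a1 x1; have a0 : 0 < a by exact: lt_le_trans a1.
rewrite (converges_time_constant (converges_scale a0 (time_constant_gt1 x1))).
by rewrite (lt_le_trans x1)// ler_peMl// ltW// (lt_trans _ x1).
Qed.

End TimeConstant.

(** * Routes on the lattice *)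

Section Fatou.
Variable R : realType.

(** The integral of a nonnegative function, measurable or not, is a supremum over the
    simple functions below it, which makes it monotone. *)
Lemma le_integral_lower d (T : measurableType d) (mu : {measure set T -> \bar R})
    (f h : T -> \bar R) :
  (forall x, 0 <= f x)%E -> (forall x, f x <= h x)%E ->
  (\int[mu]_x f x <= \int[mu]_x h x)%E.
Proof.
move=> f0 fh; have h0 x : (0 <= h x)%E := le_trans (f0 x) (fh x).
rewrite !ge0_integralTE//; apply: le_ereal_sup => _ [k kf <-].
by exists k => // x; exact: le_trans (kf x) (fh x).
Qed.

Lemma limn_einf_ge (u : nat -> \bar R) (c : \bar R) N :
  (forall n, (N <= n)%N -> c <= u n)%E -> (c <= limn_einf u)%E.
Proof.
move=> cu; rewrite limn_einf_lim; apply: lime_ge; first exact: is_cvg_einfs.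
exists N => // n /= Nn; apply: le_ereal_inf_tmp => _ [m /= nm <-].
by apply: cu; exact: leq_trans nm.
Qed.

Lemma limn_einf_le (u : nat -> \bar R) (c : \bar R) :
  (forall n, u n <= c)%E -> (limn_einf u <= c)%E.
Proof.
move=> uc; rewrite limn_einf_lim; apply: lime_le; first exact: is_cvg_einfs.
apply: nearW => n; apply: le_trans (uc n); apply: ereal_inf_lbound.
by exists n => /=.
Qed.

Lemma counting_le (T : choiceType) (A : set T) (c : \bar R) :
  (forall X : {fset T}, [set` X] `<=` A -> ((#|` X|)%:R)%:E <= c)%E ->
  (counting A <= c)%E.
Proof.
move=> Xc; rewrite /counting; case: asboolP => fA.
  by apply: Xc => x /=; rewrite in_fset_set// => /set_mem.
have big n : (n%:R%:E <= c)%E.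
  have [B BA nB] := infinite_set_fset n fA.
  by apply: le_trans (Xc B BA); rewrite lee_fin ler_nat.
case: c big {Xc} => [r||] //= big.
  have := big (Num.truncn r).+1; rewrite lee_fin leNgt => /negP[].
  exact: truncnS_gt.
by have := big 0%N.
Qed.

End Fatou.

Section LatticeRoutes.
Variables (R : realType) (d : nat) (p : R) (P : probability (config d) R).
Hypotheses (hP : is_product_measure p P) (p0 : 0 < p) (pc : p < critical_probability R d).

Lemma fset_cover_eventually (X : {fset vertex d}) (Q : vertex d -> nat -> Prop) :
  (forall v, v \in X -> exists N, forall n, (N <= n)%N -> Q v n) ->
  exists N, forall n, (N <= n)%N -> forall v, v \in X -> Q v n.
Proof.
move=> h.
have ex v : exists N, v \in X -> forall n, (N <= n)%N -> Q v n.
  have [vX|vX] := boolP (v \in X); last by exists 0%N.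
  by have [N hN] := h v vX; exists N.
exists (\max_(v <- X) sval (cid (ex v)))%N => n Nn v vX.
apply: (svalP (cid (ex v)) vX); apply: leq_trans Nn.
exact: (@leq_bigmax_seq _ _ xpredT (fun v => sval (cid (ex v)))).
Qed.

(** [route_vertices] for an arbitrary target set. *)
Definition routes_set (A : set (vertex d)) (w : config d) : set (vertex d) :=
  [set v | exists g : lpath d, is_route R w [set 0] A g /\ v \in lpath_vertices g].

(** A route on the lattice is a route of every box that contains it. *)
Lemma route_in_box A w v : routes_set A w v -> exists N, forall n, (N <= n)%N ->
  v \in box d n /\ route_points (lattice d) 0 (star (lattice d) (box d n)) A w v.
Proof.
move=> [[x st xst] [[[/= x0 Ast] tg] vst]]; subst x.
have xst' : walk (lattice d) 0 st by rewrite -is_path_walk.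
have [M sM] := walk_in_box xst'; have [N vN] := box_cover v.
exists (maxn M N) => n; rewrite geq_max => /andP[Mn Nn]; split.
  exact: (fsubsetP (box_mono _ Nn)).
exists st => //; split.
  split=> // e /sM; apply: star_mono; exact: box_mono.
move=> st' [wst' Ast' _]; rewrite -is_path_walk in wst'.
have : (((path_time w (LPath xst))%:R : R)%:E <= ((path_time w (LPath wst'))%:R)%:E)%E.
  by rewrite tg; apply: ereal_inf_lbound; exists (LPath wst').
by rewrite lee_fin ler_nat.
Qed.

Lemma depends_on_route_points (s : seq (edge d)) A (w w' : config d) : {in s, w =1 w'} ->
  route_points (lattice d) 0 s A w = route_points (lattice d) 0 s A w'.
Proof.
have sub (w1 w2 : config d) : {in s, w1 =1 w2} ->
    route_points (lattice d) 0 s A w1 `<=` route_points (lattice d) 0 s A w2.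
  move=> h v [st [ast min] vst]; exists st => //; split=> // st' ast'.
  have [_ _ sst] := ast; have [_ _ sst'] := ast'.
  rewrite -!(time_eq (w := w1)); first exact: min.
    by move=> e /sst' /h.
  by move=> e /sst /h.
by move=> h; apply/seteqP; split; apply: sub => // e es; rewrite h.
Qed.

(** The bound holds in each large box, uniformly, and passes to the limit. *)
Theorem mean_routes : exists c1 c2 : R, [/\ 0 <= c1, 0 <= c2 &
  forall (A : set (vertex d)) (L : nat),
    (exists st, [/\ walk (lattice d) 0 st, A (last 0 (unzip2 st)) & (size st <= L)%N]) ->
    (\int[P]_w counting (routes_set A w) <= (c1 + c2 * L%:R)%:E)%E].
Proof.
have [lam [th [K [[p1 lam0 lam1 th0] moment]]]] := subcritical_moment p0 pc.
pose D := size (star (lattice d) [fset 0]%fset).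
have deg v : (size (star (lattice d) [fset v]%fset) <= D)%N.
  suff -> : [fset v]%fset = shift_set v [fset 0]%fset by rewrite size_star_shift.
  by rewrite /shift_set imfset_fset1 add0r.
have K0 : 0 <= K.
  apply: le_trans (moment [::] [::] isT isT) => /=; exact: expR_ge0.
pose kap := - ln lam; have kap0 : 0 <= kap by rewrite oppr_ge0 ln_le0.
have pp0 : 0 <= (1 - p) / p by rewrite divr_ge0 ?subr_ge0// ltW.
have thV : 0 <= th^-1 by rewrite invr_ge0 ltW.
pose c2 := kap * ((1 - p) / p * (D%:R * (kap / th))) / th.
pose c1 := (K + kap * ((1 - p) / p * (D%:R * (K / th)))) / th.
have c10 : 0 <= c1.
  by rewrite /c1 mulr_ge0// addr_ge0// mulr_ge0// mulr_ge0// mulr_ge0// mulr_ge0.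
have c20 : 0 <= c2 by rewrite /c2 mulr_ge0// mulr_ge0// mulr_ge0// mulr_ge0// mulr_ge0.
exists c1, c2; split=> // A L [st0 [wst0 Ast0 st0L]].
have [M sM] := walk_in_box wst0.
pose s n := star (lattice d) (box d (n + M)).
pose f n (w : config d) := cnt R (box d (n + M)) (route_points (lattice d) 0 (s n) A w).
have f0 n w : 0 <= f n w by exact: cnt_ge0.
have fdep n (w w' : config d) : {in s n, w =1 w'} -> f n w = f n w'.
  by move=> h; rewrite /f (depends_on_route_points A h).
have fint n : (\int[P]_w (f n w)%:E <= (c1 + c2 * L%:R)%:E)%E.
  rewrite (integral_Ex hP xpredT (star_uniq (lattice d) (box d (n + M)))) //; last first.
    by move=> w w' h; apply: fdep => e es; exact: h.
  rewrite lee_fin.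
  have us := star_uniq (lattice d) (box d (n + M)).
  have short : exists2 st, admissible (lattice d) 0 (s n) A st & (size st <= L)%N.
    exists st0 => //; split=> // e /sM; apply: star_mono; apply: box_mono; exact: leq_addl.
  have := @mean_route_points R _ _ (lattice d) 0 (s n) A L us short p lam th K D
    (box d (n + M)) p0 p1 lam0 lam1 th0 (moment _ _ us (fset_uniq _)) deg.
  move=> h; apply: le_trans (h _) _.
    by move=> e /starP[x [y [xb exy]]]; exists x => //; exists y.
  (* The bound for a box is affine in [L]. *)
  rewrite le_eqVlt; apply/orP; left; apply/eqP.
  by rewrite /c1 /c2 /kap; field; rewrite !gt_eqF.
apply: le_trans (_ : (\int[P]_w limn_einf (fun n => (f n w)%:E) <= _)%E); last first.
  apply: le_trans (fatou P measurableT _ _) _ => //.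
  - by move=> n; apply/measurable_EFinP; apply: (measurable_fun_depends (s := s n)); exact: fdep.
  - by move=> n w _; rewrite lee_fin.
  - by apply: limn_einf_le.
apply: le_integral_lower => w.
  by rewrite /counting; case: asboolP => // _; rewrite lee_fin.
apply: counting_le => X XA.
have [N hN] := fset_cover_eventually (fun v vX => route_in_box (XA v vX)).
apply: (limn_einf_ge (N := N)) => n Nn; rewrite lee_fin /f.
have h v : v \in X -> v \in box d (n + M) /\
    route_points (lattice d) 0 (s n) A w v.
  by move=> vX; apply: hN => //; exact: leq_trans Nn (leq_addr _ _).
rewrite /cnt sum_ind ler_nat -size_filter; apply: uniq_leq_size; first exact: fset_uniq.
by move=> v /h[vb vr]; rewrite mem_filter vb andbT; apply/asboolP.
Qed.

End LatticeRoutes.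

Section Boundary.
Variables (R : realType) (d : nat) (G : set 'rV[R]_d).

Lemma walk_to_boundary x st : walk (lattice d) x st -> lattice_points G x ->
  ~ lattice_points G (last x (unzip2 st)) ->
  exists st', [/\ walk (lattice d) x st', lattice_boundary G (last x (unzip2 st')) &
                  (size st' <= size st)%N].
Proof.
elim: st x => [|[e y] st IH] x //= /andP[xy yst] Gx Gst.
case: (pselect (lattice_points G y)) => Gy.
  have [st' [h1 h2 h3]] := IH y yst Gy Gst.
  by exists ((e, y) :: st'); rewrite /= xy.
exists [::]; split=> //=; split=> //; exists y; split=> //.
exact: lattice_link_adjacent xy.
Qed.

Lemma embedMn (v : vertex d) n : embed R (v *+ n) = n%:R *: embed R v.
Proof. by apply/rowP => i; rewrite !mxE mulmxnE rmorphMn /= mulr_natl. Qed.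

Lemma dist1_Mn (v : vertex d) n : dist1 0 (v *+ n) = (n * dist1 0%R v)%N.
Proof.
rewrite /dist1 big_distrr; apply: eq_bigr => i _ /=.
by rewrite mulmxnE !mxE !sub0r !abszN -mulr_natl abszM natz.
Qed.

Lemma embed0 : embed R (0 : vertex d) = 0.
Proof. by apply/rowP => i; rewrite !mxE. Qed.

End Boundary.

Theorem theorem2 (R : realType) (d : nat) (p alpha1 alpha2 : R)
    (P : probability (config d) R)
    (hd : (2 <= d)%N)
    (hp0 : 0 < p) (hpc : p < critical_probability R d)
    (hP : is_product_measure p P)
    (ha0 : 0 < alpha1) (ha1 : alpha1 < 1) (ha2 : 1 < alpha2) :
  exists C : R, forall (t : R) (G : set 'rV[R]_d),
    1 <= t ->
    connected G ->
    dilate (alpha1 * t) (asymptotic_shape P) `<=` G ->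
    G `<=` dilate (alpha2 * t) (asymptotic_shape P) ->
    (\int[P]_w counting (route_vertices w G) <= (C * t)%:E)%E.
Proof.
have [c1 [c2 [c10 c20 bound]]] := mean_routes hP hp0 hpc.
have in_shape (a : R) (x : 'rV[R]_d) : 0 < a -> time_constant P (a^-1 *: x) <= 1 ->
    dilate a (asymptotic_shape P) x.
  by move=> a0 h; exists (a^-1 *: x) => //; rewrite scalerA divff ?gt_eqF// scale1r.
case: (pselect (exists (v : vertex d) (r : R), 0 < r /\
    1 < time_constant P (r *: embed R v))) => [[v [r [r0 vr]]]|no]; last first.
  (* Then [G] contains all lattice vertices and there is no boundary to reach. *)
  exists 0 => t G t1 _ sG Gs.
  have at0 : 0 < alpha1 * t by rewrite mulr_gt0// (lt_le_trans ltr01).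
  have full u : lattice_points G u.
    apply: sG; apply: in_shape => //; rewrite leNgt; apply/negP => h.
    by apply: no; exists u, (alpha1 * t)^-1; rewrite invr_gt0.
  rewrite mul0r (eq_integral (cst 0%E)) ?integral0// => w _.
  have -> : route_vertices w G = set0.
    apply/seteqP; split=> // u [g [[[_ [_ [z [_ nz]]]] _] _]].
    by case: nz; exact: full.
  rewrite /counting asboolT; last exact: finite_set0.
  by rewrite fset_set0 cardfs0.
pose ell := dist1 0 v.
exists (c1 + c2 * ((alpha2 * r + 1) * ell%:R)) => t G t1 _ sG Gs.
have t0 : 0 < t by rewrite (lt_le_trans ltr01).
have a20 : 0 < alpha2 by rewrite (lt_trans ltr01).
have at0 : 0 < alpha1 * t by rewrite mulr_gt0.
have at20 : 0 < alpha2 * t by rewrite mulr_gt0.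
(* The choice of [n] makes [n v / (alpha2 t)] a multiple of [r v] by a factor at
   least 1. *)
pose n := (Num.truncn (alpha2 * t * r)).+1.
have nlow : alpha2 * t * r <= n%:R by rewrite ltW// truncnS_gt.
have nup : n%:R <= (alpha2 * r + 1) * t.
  have : (Num.truncn (alpha2 * t * r))%:R <= alpha2 * t * r.
    by rewrite truncn_le mulr_ge0// ltW.
  rewrite /n -natr1; nra.
have G0 : lattice_points G 0.
  by apply: sG; apply: in_shape => //; rewrite embed0 scaler0 time_constant0.
have Gn : ~ lattice_points G (v *+ n).
  move=> /Gs[x /= x1 xv].
  have : 1 < time_constant P ((n%:R / (alpha2 * t * r)) *: (r *: embed R v)).
    by apply: time_constant_ray => //; rewrite ler_pdivlMr ?mul1r// mulr_gt0.
  suff -> : (n%:R / (alpha2 * t * r)) *: (r *: embed R v) = x.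
    by rewrite ltNge x1.
  apply: (scalerI (a := alpha2 * t)); first by rewrite gt_eqF.
  rewrite xv embedMn !scalerA; congr (_ *: _).
  by field; rewrite !gt_eqF.
have [st wst [lst sst]] := dist1_path 0 (v *+ n).
rewrite is_path_walk in wst.
have [|st' [wst' bst' sst']] := walk_to_boundary wst G0; first by rewrite lst.
apply: le_trans (bound (lattice_boundary G) (n * ell)%N _) _.
  by exists st'; split=> //; rewrite -dist1_Mn -sst.
rewrite lee_fin mulrDl; apply: lerD; first by rewrite ler_peMr.
rewrite -mulrA ler_wpM2l// natrM mulrAC ler_wpM2r//.
Qed.
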